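(* Let $a_1,\ldots,a_r\in\mathbb{Q}$. Then there exists a probability distribution of a random vector $(X_1,\ldots,X_r)$ on $\mathbb{Q}^r$ which is supported on a finite subset of the hyperplane $\{x\in\mathbb{Q}^r:\sum_{i=1}^r a_ix_i=0\}$, which is not the point mass at the origin, and whose marginals $X_1,\ldots,X_r$ are all equal in distribution, if and only if the following local conditions hold: (i) for every prime $p$ and every $i$, $|a_i|_p\le \max_{j\ne i}|a_j|_p$; (ii) for every $i$, $|a_i|\le \sum_{j\ne i}|a_j|$ (usual real absolute value).
   Context: $|\cdot|_p$ denotes the $p$-adic absolute value on $\mathbb{Q}$. *)

(* Defs.v *)
From HB Require Import structures.
From mathcomp Require Import all_boot all_order all_algebra.
From mathcomp Require Import all_classical all_reals all_analysis.

Set Implicit Arguments.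
Unset Strict Implicit.
Unset Printing Implicit Defensive.

Import Order.TTheory GRing.Theory Num.Theory.

Local Open Scope classical_set_scope.
Local Open Scope ring_scope.

Definition padic_val (p : nat) (x : rat) : int :=
  (logn p `|numq x|%N)%:Z - (logn p `|denq x|%N)%:Z.

Definition padic_abs (p : nat) (x : rat) : rat :=
  if x == 0 then 0 else (p%:R : rat) ^ (- padic_val p x).

(* Q carries the discrete sigma-algebra, which is also its Borel
   sigma-algebra; Q^r is [r.-tuple rat] with the product sigma-algebra, which
   is again discrete (see [measurable_tuple_rat]). *)
HB.instance Definition _ := @isMeasurable.Build default_measure_display
  rat (@discrete_measurable rat) (@discrete_measurable0 rat)
  (@discrete_measurableC rat) (@discrete_measurableU rat).

Lemma measurable_tuple_rat (r : nat) (A : set (r.-tuple rat)) : measurable A.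
Proof.
have mset1 (x : r.-tuple rat) : measurable [set x].
  have -> : [set x] =
      \bigcap_(i in [set: 'I_r]) ((fun y => tnth y i) @^-1` [set tnth x i]).
    apply/seteqP; split => [y -> i _ //|y xy].
    by apply: eq_from_tnth => i; exact: xy.
  apply: fin_bigcap_measurable => [|i _]; first exact: finite_finset.
  by rewrite -[X in measurable X]setTI; exact: measurable_tnth.
have -> : A = \bigcup_x ([set x] `&` [set y | A y]).
  by apply/seteqP; split => [y Ay|y [x _ [-> //]]]; exists y.
apply: countable_bigcupT_measurable => [|x]; first exact: countableP.
have [Ax|nAx] := pselect (A x).
  by rewrite (_ : _ `&` _ = [set x]) //; apply/seteqP; split => [y []|y ->].
rewrite (_ : _ `&` _ = set0); first exact: measurable0.
by apply/seteqP; split => [y [-> //]|].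
Qed.

Definition coordinate (r : nat) (i : 'I_r) (x : r.-tuple rat) : rat := tnth x i.

Lemma measurable_coordinate (r : nat) (i : 'I_r) : measurable_fun setT (coordinate i).
Proof. exact: measurable_tnth. Qed.

HB.instance Definition _ (r : nat) (i : 'I_r) :=
  isMeasurableFun.Build _ _ _ _ (coordinate i) (measurable_coordinate i).

Definition hyperplane (r : nat) (a : 'I_r -> rat) : set (r.-tuple rat) :=
  [set x | \sum_(i < r) a i * coordinate i x = 0].

Definition origin (r : nat) : r.-tuple rat := [tuple 0 | _ < r].

Definition same_law (d : measure_display) (T : measurableType d) (R : realType)
    (mu nu : set T -> \bar R) : Prop :=
  forall A, measurable A -> mu A = nu A.

Definition finitely_supported_in (d : measure_display) (T : measurableType d)
    (R : realType) (mu : probability T R) (H : set T) : Prop :=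
  exists S : set T, [/\ finite_set S, S `<=` H & mu S = 1%E].

(* Main.v *)
Require Import Defs.
From HB Require Import structures.
From mathcomp Require Import all_boot all_order all_algebra.
From mathcomp Require Import all_classical all_reals all_analysis.
From mathcomp Require Import ring lra zify.
From mathcomp Require Import polyrcf realalg.

(* A marginal value of extremal absolute value at a place v, realised by an atom of
   the law, shows that both local conditions are necessary.

   Conversely let a be integral and L the lattice of integer points of the hyperplane.
   Equality in (ii) is solved by a sign vector, so (ii) may be assumed strict.
   1. Take a random walk on L whose steps have coordinates with the same moments up
   to a large order M.  The steps are sums of independent Bernoulli multiples of
   vectors x of L, so that cumulants add up: the x are chosen with equal coordinate
   variances, which strictness in (ii) permits, and along each x a mixture of Bernoulli
   parameters cancels the even cumulants of order 4, 6, ..., which is possible because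
   the Bernoulli cumulants of order at least 3 take both signs.  After N = M k^2 + 1
   steps two column laws differ by O(k^2 / k^M), while the walk puts mass at least
   c / k^(2r) at every prescribed point of L.
   2. Condition (i) and strictness in (ii) give, for every large n and every i, a
   point of L whose i-th coordinate is n and whose other coordinates are smaller by a
   constant factor.  Adding such points moves the discrepancy of the column laws to a
   fixed neighbourhood of 0, multiplying it by at most a power of its support.
   3. The discrepancies supported near 0 and realised by signed measures on L form a
   finite-dimensional space, so the remaining one is realised by a signed measure of
   controlled size on a fixed finite subset of L, where the walk dominates it. *)

Set Implicit Arguments.
Unset Strict Implicit.
Unset Printing Implicit Defensive.

Import Order.TTheory GRing.Theory Num.Theory.

Local Open Scope classical_set_scope.
Local Open Scope ring_scope.

(** * Cumulants of Bernoulli laws *)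

(* [(bcum n).[u]] is the cumulant of order [n.+1] of the Bernoulli law of parameter [u]. *)
Fixpoint bcum (n : nat) : {poly rat} :=
  if n is m.+1 then 'X * (1 - 'X) * (bcum m)^`() else 'X.

(** This is the coefficient of [z^n / n!] in [G' = (log G)' * G] for [G = 1 - u + u * exp z], the
    generating function of a Bernoulli variable. The induction applies the operator
    ['X * (1 - 'X) * d/d'X], which raises the order of the cumulants by one. *)
Lemma bcum_rec n :
  'X = (1 - 'X) * bcum n + 'X * \sum_(k < n.+1) ((bcum k) *+ 'C(n, k)).
Proof.
elim: n => [|n IH].
  by rewrite big_ord_recl big_ord0 /= bin0; ring.
have E := congr1 (fun p : {poly rat} => 'X * (1 - 'X) * p^`()) IH.
rewrite /= derivD !derivM derivB derivX derivC (raddf_sum (@deriv rat)) in E.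
set S0 := \sum_(k < n.+1) _ in IH E.
set S1 := \sum_(k < n.+1) _ in E.
have S1E : 'X * (1 - 'X) * S1 = \sum_(k < n.+1) (bcum k.+1 *+ 'C(n, k)).
  rewrite mulr_sumr; apply: eq_bigr => k _.
  by rewrite /= (raddfMn (@deriv rat)) mulrnAr.
have S2E : \sum_(k < n.+2) (bcum k *+ 'C(n.+1, k)) = S0 + 'X * (1 - 'X) * S1.
  rewrite S1E big_ord_recl /= bin0.
  under eq_bigr do rewrite binS mulrnDr.
  rewrite big_split /= addrA; congr (_ + _).
  rewrite [LHS]addrC big_ord_recr /= bin_small // mulr0n addr0 addrC /S0 big_ord_recl bin0.
  by [].
rewrite S2E [bcum n.+1]/=; clear S2E S1E.
set K' := (bcum n)^`() in E *.
have : (1 - 'X) * bcum n = 'X - 'X * S0 by apply/eqP; rewrite eq_sym subr_eq -IH.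
set K := bcum n in E * => HK.
have E2 : 'X * (1 - 'X) * 1 = - 'X * ('X - 'X * S0) + 'X * ((1 - 'X)^+2 * K')
    + 'X * (1-'X) * S0 + 'X * ('X * (1-'X) * S1).
  by rewrite E -HK; ring.
have -> : (1 - 'X) * ('X * (1 - 'X) * K') = 'X * ((1 - 'X)^+2 * K') by ring.
have -> : 'X * ((1 - 'X) ^+ 2 * K') = 'X * (1 - 'X) * 1 + 'X * ('X - 'X * S0) - 'X * (1-'X) * S0 - 'X * ('X * (1-'X) * S1) by rewrite {1}E2; ring.
ring.
Qed.

Lemma bcum0 n : (bcum n).[0] = 0.
Proof. by case: n => [|n]; rewrite /= ?hornerE // !hornerM hornerX !mul0r. Qed.

Lemma bcum_deriv0 n : ((bcum n)^`()).[0] = 1.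
Proof.
elim: n => [|n IH] /=; first by rewrite derivX hornerC.
by rewrite !derivM derivX derivB derivX derivC !hornerE IH; lra.
Qed.

Lemma bcum1 n : (bcum n.+1).[1] = 0.
Proof. by rewrite /= !hornerE; lra. Qed.

Lemma rat_near (R : archiRealFieldType) (x d : R) : 0 < d -> exists q : rat, `|ratr q - x| < d.
Proof.
move=> d0; pose N := (Num.bound (d^-1)).
have Nd : d^-1 < N%:R by apply: archi_boundP; rewrite invr_ge0 ltW.
have N0 : 0 < N%:R :> R by apply: le_lt_trans Nd; rewrite invr_ge0 ltW.
exists ((Num.floor (x * N%:R))%:~R / N%:R).
rewrite rmorphM /= fmorphV rmorph_nat ratr_int.
have /andP[f1 f2] := floor_itv (x * N%:R).
have -> : (Num.floor (x * N%:R))%:~R / N%:R - x = - ((x * N%:R - (Num.floor (x * N%:R))%:~R) / N%:R).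
  by field; rewrite gt_eqF.
rewrite normrN ger0_norm; last first.
  by rewrite divr_ge0 ?(ltW N0) // subr_ge0.
rewrite ltr_pdivrMr //; apply: (@lt_trans _ _ 1).
  by rewrite ltrBlDr addrC; move: f2; rewrite intrD mulr1z.
by rewrite -(@ltr_pM2l _ d) // in Nd; rewrite mulfV ?gt_eqF // in Nd.
Qed.

(** The mean value theorem gives such a point in the real closed field [R], and continuity of the
    derivative moves it to a nearby rational. *)
Lemma poly_neg_deriv (R : archiRcfType) (p : {poly rat}) (a b : rat) : a < b -> p.[b] < p.[a] ->
  exists u, [/\ a < u, u < b & p^`().[u] < 0].
Proof.
move=> ab pab; pose f := @ratr R; pose P := map_poly f p.
have fab : f a < f b by rewrite ltr_rat.
have [c] := poly_mvt P fab.
rewrite in_itv /= => /andP[ac cb].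
rewrite deriv_map !horner_map /= => E.
have Pc : (map_poly f p^`()).[c] < 0.
  have: f p.[b] - f p.[a] < 0 by rewrite subr_lt0 ltr_rat.
  by rewrite E pmulr_llt0 // subr_gt0.
have [d d0 dP] : exists2 d, 0 < d & forall y, `|y - c| < d -> `|(map_poly f p^`()).[y] - (map_poly f p^`()).[c]| < - (map_poly f p^`()).[c].
  by apply: poly_cont; rewrite oppr_gt0.
have [|q] := @rat_near _ c (Num.min d (Num.min (c - f a) (f b - c))).
  by rewrite !lt_min !subr_gt0 d0 ac cb.
rewrite !lt_min => /and3P[q1 q2 q3].
exists q; split.
- by rewrite -(@ltr_rat R); move: q2; rewrite ltr_norml /f => /andP[]; lra.
- by rewrite -(@ltr_rat R); move: q3; rewrite ltr_norml /f => /andP[_]; lra.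
rewrite -(@ltrq0 R) -horner_map.
by have := dP _ q1; rewrite ltr_norml => /andP[_] /=; rewrite -/f; lra.
Qed.

(** Division by ['X] leaves a polynomial that is positive at 0, hence at small positive
    rationals. *)
Lemma poly_pos_near0 (R : archiRcfType) (p : {poly rat}) : p.[0] = 0 -> 0 < p^`().[0] ->
  exists u, [/\ 0 < u, u < 1 & 0 < p.[u]].
Proof.
move=> p0 dp0; have /factor_theorem[q pE] : root p 0 by apply/rootP.
rewrite subr0 in pE.
have q0 : 0 < q.[0] by move: dp0; rewrite pE derivM derivX !hornerE ?mulr0 ?add0r.
pose P := map_poly (@ratr R) q.
have P0 : 0 < P.[0].
  have -> : P.[0] = ratr q.[0] by rewrite -horner_map rmorph0.
  by rewrite ltr0q.
have [d d0 dP] := poly_cont 0 P P0.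
pose e := Num.min d 1 / 2.
have e0 : 0 < e by rewrite divr_gt0 // lt_min d0 ltr01.
have e1 : 2 * e <= 1 by rewrite mulrC divfK ?pnatr_eq0 // ge_min lexx orbT.
have ed : 2 * e <= d by rewrite mulrC divfK ?pnatr_eq0 // ge_min lexx.
have [u] := rat_near e e0; rewrite ltr_norml => /andP[u1 u2].
have u0 : 0 < u by rewrite -(@ltr0q R); lra.
exists u; split => //; first by rewrite -(@ltr_rat R) rmorph1; lra.
rewrite pE !hornerE pmulr_lgt0 // -(@ltr0q R) -horner_map -/P.
have := dP (ratr u); rewrite subr0 ger0_norm; last by rewrite ler0q ltW.
by move=> /(_ ltac:(lra)); rewrite ltr_norml => /andP[]; lra.
Qed.

Lemma bcum_pos n : exists u, [/\ 0 < u, u < 1 & 0 < (bcum n).[u]].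
Proof. by apply: (@poly_pos_near0 realalg); rewrite ?bcum0 ?bcum_deriv0. Qed.

(** [bcum n.+1] is positive somewhere in the unit interval and vanishes at 1, so its derivative is
    negative in between. This starts at order 3: the variance [u * (1 - u)] does not change sign. *)
Lemma bcum_neg n : exists u, [/\ 0 < u, u < 1 & (bcum n.+2).[u] < 0].
Proof.
have [v [v0 v1 kv]] := bcum_pos n.+1.
have [|u [vu u1 du]] := @poly_neg_deriv realalg (bcum n.+1) _ _ v1; first by rewrite bcum1.
have u0 := lt_trans v0 vu.
exists u; split => //.
by rewrite [bcum n.+2]/= !hornerM pmulr_rlt0 // !hornerE mulr_gt0 // subr_gt0.
Qed.

(** An entry [(c, (u, h))] stands for [c] copies of [h] times a Bernoulli variable of parameter [u].
    The value is the cumulant of order [2 k + 4] of the independent sum. *)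
Definition cum_sum (l : seq (rat * (rat * nat))) (k : nat) : rat :=
  \sum_(p <- l) p.1 * ((bcum (k.*2 + 3)).[p.2.1] * p.2.2%:R ^+ (k.*2 + 4)).

Definition admissible (l : seq (rat * (rat * nat))) :=
  all (fun p => [&& 0 <= p.1, 0 < p.2.1, p.2.1 < 1 & (0 < p.2.2)%N]) l.

Definition wscale {T : Type} (c : rat) (l : seq (rat * T)) := [seq (c * p.1, p.2) | p <- l].

Lemma cum_sum_cat l l' k : cum_sum (l ++ l') k = cum_sum l k + cum_sum l' k.
Proof. by rewrite /cum_sum big_cat. Qed.

Lemma cum_sum_scale c l k : cum_sum (wscale c l) k = c * cum_sum l k.
Proof. by rewrite /cum_sum big_map mulr_sumr; apply: eq_bigr => p _; rewrite mulrA. Qed.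

Lemma admissible_cat l l' : admissible (l ++ l') = admissible l && admissible l'.
Proof. exact: all_cat. Qed.

Lemma admissible_scale c l : 0 <= c -> admissible l -> admissible (wscale c l).
Proof.
move=> c0 /allP H; apply/allP => _ /mapP[p /H/and4P[p1 p2 p3 p4] ->].
by rewrite /= mulr_ge0 ?p2 ?p3.
Qed.

Lemma poly_dom (c : rat) (f : nat -> rat) m : 0 < c ->
  exists2 H : nat, (0 < H)%N & \sum_(k < m) H%:R ^+ (k.*2 + 4) * f k < c * H%:R ^+ (m.*2 + 4).
Proof.
move=> c0; pose S := \sum_(k < m) `|f k|.
have S0 : 0 <= S by apply: sumr_ge0.
pose H := (Num.bound (S / c)).+1; exists H => //.
have HH : S < c * H%:R.
  rewrite mulrC -ltr_pdivrMr //; apply: lt_le_trans (archi_boundP _) _; first by rewrite divr_ge0 // ltW.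
  by rewrite ler_nat.
have H1 : 1 <= H%:R :> rat by rewrite ler1n.
case: m @S S0 @H HH H1 => [|m] S S0 H HH H1.
  by rewrite big_ord0 mulr_gt0 // exprn_gt0 // ltr0n.
apply: (@le_lt_trans _ _ (H%:R ^+ (m.+1.*2 + 3) * S)); last first.
  have -> : (m.+1.*2 + 4 = (m.+1.*2 + 3).+1)%N by lia.
  by rewrite [in ltRHS]exprS mulrA mulrC ltr_pM2r // exprn_gt0 // ltr0n.
rewrite /S mulr_sumr; apply: ler_sum => k _.
apply: (@le_trans _ _ (H%:R ^+ (k.*2 + 4) * `|f k|)).
  by rewrite ler_wpM2l ?ler_norm // exprn_ge0.
rewrite ler_wpM2r // ler_weXn2l //; have := ltn_ord k; lia.
Qed.

(** Induction, one order at a time. It is enough to reach the last order with either sign while the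
    lower ones are zero: [bcum_pos] and [bcum_neg] give a parameter of the right sign, and the
    induction hypothesis cancels the lower orders. *)
Lemma cum_sum_full m (y : nat -> rat) :
  exists2 l, admissible l & forall k, (k < m)%N -> cum_sum l k = y k.
Proof.
elim: m y => [|m IH] y; first by exists [::].
have step (sg : rat) : sg != 0 ->
    (exists u, [/\ 0 < u, u < 1 & 0 < sg * (bcum (m.*2 + 3)).[u]]) ->
    exists l, [/\ admissible l, forall k, (k < m)%N -> cum_sum l k = 0 & 0 < sg * cum_sum l m].
  move=> sg0 [u [u0 u1 su]].
  have /fin_all_exists[f fP] : forall j : 'I_m, exists l, admissible l /\
      forall k, (k < m)%N -> cum_sum l k = (k == j)%:R * - (bcum (k.*2 + 3)).[u].
    by move=> j; have [l l1 l2] := IH (fun k => (k == j)%:R * - (bcum (k.*2 + 3)).[u]); exists l.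
  pose g j := if insub j is Some j' then cum_sum (f j') m else 0.
  (* The correction at index [j] is scaled by [H ^ (2 j + 4)], so for large [H] its side effect at
     index [m] is small against the main term, of size [H ^ (2 m + 4)]. *)
  have [H H0 HP] := poly_dom (fun j => - (sg * g j)) m su.
  pose L := flatten [seq wscale (H%:R ^+ (j.*2 + 4)) (f j) | j : 'I_m <- enum 'I_m].
  have LE k : cum_sum L k = \sum_(j < m) H%:R ^+ (j.*2 + 4) * cum_sum (f j) k.
    rewrite /L /cum_sum big_flatten big_map big_enum /=.
    by apply: eq_bigr => j _; rewrite -/(cum_sum _ _) cum_sum_scale.
  exists ((1, (u, H)) :: L); split.
  - rewrite /= u0 u1 H0 /=; apply/allP => p /flatten_mapP[j _ pj].
    have [af _] := fP j; have := admissible_scale (exprn_ge0 (j.*2 + 4) (ler0n _ H)) af.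
    by move=> /allP/(_ p pj).
  - move=> k km; rewrite /cum_sum big_cons -/(cum_sum _ _) LE /= mul1r.
    rewrite (bigD1 (Ordinal km)) //= (fP _).2 // eqxx mul1r big1 ?addr0; first by ring.
    move=> j /eqP jk; rewrite (fP _).2 //; case: eqP => [kj|_]; last by rewrite mul0r mulr0.
    by case: jk; apply: val_inj.
  rewrite /cum_sum big_cons -/(cum_sum _ _) LE /= mul1r mulrDr mulr_sumr.
  rewrite mulrA -[X in _ + X]opprK subr_gt0 -sumrN; apply: le_lt_trans HP; rewrite le_eqVlt.
  apply/orP; left; apply/eqP; apply: eq_bigr => j _.
  by rewrite /g valK; ring.
have [l1 a1 l1P] := IH y; pose z := y m - cum_sum l1 m.
have [l2 a2 [l2P l2z]] : exists2 l, admissible l & (forall k, (k < m)%N -> cum_sum l k = 0) /\ cum_sum l m = z.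
  have key sg : sg != 0 -> (exists l, [/\ admissible l, forall k, (k < m)%N -> cum_sum l k = 0 & 0 < sg * cum_sum l m]) ->
     0 <= sg * z -> exists2 l, admissible l & (forall k, (k < m)%N -> cum_sum l k = 0) /\ cum_sum l m = z.
    move=> sg0 [l [al lP lm]] sz; exists (wscale (sg * z / (sg * cum_sum l m)) l).
      by rewrite admissible_scale // divr_ge0 // ltW.
    split=> [k km|]; first by rewrite cum_sum_scale (lP k km) mulr0.
    rewrite cum_sum_scale.
    have : cum_sum l m != 0 by apply/eqP => c0; rewrite c0 mulr0 ltxx in lm.
    by move=> ?; field; apply/andP.
  have [z0|z0] := leP 0 z.
    apply: (key 1) => //; last by rewrite mul1r.
    apply: step => //; have [u [? ? ?]] := bcum_pos (m.*2 + 3); exists u; split => //.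
    by rewrite mul1r.
  apply: (key (-1)) => //; last by rewrite mulN1r oppr_ge0 ltW.
  apply: step => //; have [u [? ? ?]] := bcum_neg (m.*2.+1); exists u; split => //.
  by rewrite mulN1r oppr_gt0 addn3.
exists (l1 ++ l2) => [|k]; first by rewrite admissible_cat a1.
rewrite ltnS leq_eqVlt cum_sum_cat => /predU1P[->|km]; first by rewrite l2z /z; ring.
by rewrite l1P // l2P // addr0.
Qed.

(** * Weighted lattice points and matching of moments *)

(** A common denominator [D] turns rational weights into multiplicities, since a sum of independent
    variables contains each summand a whole number of times. *)
Lemma unweight (T : Type) (l : seq (rat * T)) : all (fun p => 0 <= p.1) l ->
  exists (D : nat) (rep : seq T), [/\ (0 < D)%N,
    forall f : T -> rat, \sum_(t <- rep) f t = D%:R * \sum_(p <- l) p.1 * f p.2 &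
    forall P : pred T, all (fun p => P p.2) l -> all P rep].
Proof.
elim: l => [|[c t] l IH] /=; first by exists 1%N, [::]; split => // f; rewrite !big_nil mulr0.
case/andP => c0 /IH[D [rep [D0 HD HP]]].
pose n := `|numq c|%N; pose d := `|denq c|%N.
have dE : (d%:R : rat) = (denq c)%:~R by rewrite -[d%:R]/(d%:Z%:~R) /d gez0_abs // ltW // denq_gt0.
have nE : (n%:R : rat) = (numq c)%:~R by rewrite -[n%:R]/(n%:Z%:~R) /n gez0_abs // numq_ge0.
have d0 : (0 < d)%N by rewrite absz_gt0 denq_neq0.
exists (D * d)%N, (nseq (n * D) t ++ flatten (nseq d rep)); split.
- by rewrite muln_gt0 D0.
- move=> f; rewrite big_cat big_cons /= big_flatten !big_nseq !iter_addr_0 HD.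
  have -> : c = n%:R / d%:R by rewrite nE dE divq_num_den.
  rewrite -mulr_natl -[X in _ + X]mulr_natl !natrM; field.
  by rewrite pnatr_eq0 -lt0n.
move=> P /andP[Pt Pl]; rewrite all_cat all_nseq Pt orbT /=.
by elim: (d) => //= k IHk; rewrite all_cat HP.
Qed.

(** A fair Bernoulli variable of size 1 is kept, and the other entries cancel its even cumulants
    from order 4 on. The fair entry later gives the factor [half_step] of the column polynomials and
    the mass of the walk at prescribed points. *)
Lemma one_dim m : exists l : seq (rat * nat),
  [/\ (2^-1, 1%N) \in l, all (fun p => [&& 0 < p.1, p.1 < 1 & (0 < p.2)%N]) l &
      forall k, (k < m)%N -> \sum_(p <- l) (bcum (k.*2 + 3)).[p.1] * p.2%:R ^+ (k.*2 + 4) = 0].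
Proof.
have [l al lP] := cum_sum_full m (fun k => - (bcum (k.*2 + 3)).[2^-1]).
have [|D [rep [D0 HD HP]]] := @unweight _ l; first by apply: sub_all al => p /and4P[].
exists (nseq D (2^-1, 1%N) ++ rep); split.
- by rewrite mem_cat mem_nseq D0 eqxx.
- rewrite all_cat all_nseq /= orbT /=; apply: HP; apply: sub_all al => p /and4P[_ -> -> ->].
  by [].
move=> k km; rewrite big_cat big_nseq iter_addr_0 /=.
rewrite (HD (fun p => (bcum (k.*2 + 3)).[p.1] * p.2%:R ^+ (k.*2 + 4))).
by rewrite -/(cum_sum l k) lP // expr1n mulr1 -[X in X + _]mulr_natl mulrN subrr.
Qed.

Definition orth r (a : 'I_r -> int) (x : 'rV[int]_r) := \sum_i a i * x 0 i == 0.

Lemma orthD r (a : 'I_r -> int) x y : orth a x -> orth a y -> orth a (x + y).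
Proof.
rewrite /orth => /eqP x0 /eqP y0; under eq_bigr do rewrite mxE mulrDr.
by rewrite big_split /= x0 y0 addr0.
Qed.

Lemma orthMn r (a : 'I_r -> int) x n : orth a x -> orth a (x *+ n).
Proof.
rewrite /orth => /eqP x0; under eq_bigr do rewrite mulmxnE mulrnAr.
by rewrite sumrMnl x0 mul0rn.
Qed.

Lemma orthN r (a : 'I_r -> int) x : orth a x -> orth a (- x).
Proof.
rewrite /orth => /eqP x0; under eq_bigr do rewrite mxE mulrN.
by rewrite sumrN x0 oppr0.
Qed.

Lemma orthZ r (a : 'I_r -> int) c x : orth a x -> orth a (c *: x).
Proof.
rewrite /orth => /eqP x0; under eq_bigr do rewrite mxE mulrCA.
by rewrite -mulr_sumr x0 mulr0.
Qed.

Lemma orth0 r (a : 'I_r -> int) : orth a 0.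
Proof. by apply/eqP/big1 => i _; rewrite mxE mulr0. Qed.

(** When [a i] is nonzero, let [c] be the sum of the other absolute values and take the entry [c] at
    [i] and [|a i|] elsewhere, with signs that make the terms of the scalar product cancel.
    Strictness makes the entry at [i] the largest. *)
Lemma spike r (a : 'I_r -> int) (i : 'I_r) :
  `|a i| < \sum_(j < r | j != i) `|a j| ->
  exists (v : 'rV[int]_r) (t s : int), [/\ orth a v, 0 <= t, 0 < s &
    forall j, (v 0 j) ^+ 2 = t + s * (j == i)%:R].
Proof.
move=> ai; have [a0|a0] := eqVneq (a i) 0.
  exists (delta_mx 0 i), 0, 1; split => //.
    rewrite /orth (bigD1 i) //= a0 mul0r add0r big1 // => j /negPf ji.
    by rewrite mxE ji andbF mulr0.
  by move=> j; rewrite mxE eqxx /= add0r mul1r; case: eqP => // _; rewrite expr0n.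
pose c := \sum_(j < r | j != i) `|a j|.
pose sg' (z : int) : int := if 0 <= z then 1 else -1.
have sgE z : z * sg' z = `|z| by rewrite /sg'; case: ifP; lia.
have sg2 z : sg' z ^+ 2 = 1 by rewrite /sg'; case: ifP.
exists (\row_j (if j == i then - sg' (a i) * c else `|a i| * sg' (a j))).
exists (a i ^+ 2), (c ^+ 2 - a i ^+ 2); split.
- rewrite /orth (bigD1 i) //= mxE eqxx mulrA mulrN sgE.
  under eq_bigr => j ji do rewrite mxE (negPf ji) mulrCA sgE.
  by rewrite -mulr_sumr -/c mulNr addNr.
- exact: sqr_ge0.
- rewrite subr_gt0 -[ltLHS]real_normK ?num_real // ltr_pXn2r ?nnegrE //.
  exact: le_trans (ltW ai).
move=> j; rewrite mxE; case: eqP => _.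
  by rewrite exprMn sqrrN sg2 /= mul1r mulr1 addrC subrK.
by rewrite exprMn sg2 mulr0 mulr1 addr0 real_normK ?num_real.
Qed.

(** Adding the vector [v i] of [spike] raises all second moments equally, except for a surplus [s i]
    at [i]. The weight [n i] uses this surplus to lift [Z i] to the common upper bound [l]. *)
Lemma equal_variance r (a : 'I_r -> int) (X0 : seq 'rV[int]_r) :
  (forall i, `|a i| < \sum_(j < r | j != i) `|a j|) -> all (orth a) X0 ->
  exists Xs : seq 'rV[int]_r, [/\ all (orth a) Xs, {subset X0 <= Xs} &
    forall i j, \sum_(x <- Xs) (x 0 i)%:~R ^+ 2 = \sum_(x <- Xs) (x 0 j)%:~R ^+ 2 :> rat].
Proof.
move=> ha oX0.
have /fin_all_exists[v] := fun i => spike (ha i).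
move=> /fin_all_exists[t] /fin_all_exists[s vP].
pose Z i : rat := \sum_(x <- X0) (x 0 i)%:~R ^+ 2.
have Z0 i : 0 <= Z i by apply: sumr_ge0 => x _; apply: sqr_ge0.
pose l := \sum_i Z i.
have Zl i : Z i <= l by rewrite /l (bigD1 i) //= lerDl sumr_ge0.
have s0 i : 0 < (s i)%:~R :> rat by rewrite ltr0z; case: (vP i).
pose n i := (l - Z i) / (s i)%:~R.
have [|D [rep [D0 HD HP]]] := @unweight _ [seq (n i, v i) | i <- enum 'I_r].
  by apply/allP => _ /mapP[i _ ->] /=; rewrite divr_ge0 ?subr_ge0 // ltW.
exists (flatten (nseq D X0) ++ rep); split.
- rewrite all_cat; apply/andP; split.
    by apply/allP => x /flattenP[q]; rewrite mem_nseq => /andP[_ /eqP->] /(allP oX0).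
  by apply: HP; apply/allP => _ /mapP[i _ ->] /=; case: (vP i).
- move=> x xX; rewrite mem_cat; apply/orP; left; apply/flattenP; exists X0 => //.
  by rewrite mem_nseq D0 eqxx.
have E j : \sum_(x <- flatten (nseq D X0) ++ rep) (x 0 j)%:~R ^+ 2 =
    D%:R * (l + \sum_i n i * (t i)%:~R) :> rat.
  rewrite big_cat big_flatten /= big_nseq iter_addr_0 -/(Z j) HD big_map big_enum /=.
  under eq_bigr => i _.
    have [_ _ _ /(_ j) H] := vP i.
    rewrite -[_ ^+ 2]rmorphXn /= H rmorphD rmorphM /= mulrDr.
    over.
  rewrite big_split /= [X in _ * (_ + X)](bigD1 j) //= eqxx mulr1 /n divfK ?gt_eqF //.
  rewrite [X in l - _ + X]big1 ?addr0; last by move=> i /negPf ij; rewrite eq_sym ij !mulr0.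
  by rewrite -mulr_natl; ring.
by move=> i j; rewrite !E.
Qed.

(** A finitely supported signed measure. A point may occur in several entries, so its mass is
    [pmass] and not a single weight. *)
Definition meas r := seq (rat * 'rV[int]_r).
Definition ev r (s : meas r) (f : 'rV[int]_r -> rat) : rat := \sum_(p <- s) p.1 * f p.2.
Definition conv r (s t : meas r) : meas r := [seq (p.1 * q.1, p.2 + q.2) | p <- s, q <- t].
Definition refl r (s : meas r) : meas r := [seq (p.1, - p.2) | p <- s].
(* For [f = (u, x)], the law of [B x] where [B] is a Bernoulli variable of parameter [u]. *)
Definition bern_law r (f : rat * 'rV[int]_r) : meas r := [:: (1 - f.1, 0); f].
Definition bern_sum r (Fs : seq (rat * 'rV[int]_r)) : meas r :=
  foldr (fun f s => conv (bern_law f) s) [:: (1, 0)] Fs.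

Lemma eq_ev r (s : meas r) f g : f =1 g -> ev s f = ev s g.
Proof. by move=> fg; apply: eq_bigr => p _; rewrite fg. Qed.

Lemma ev_conv r (s t : meas r) f : ev (conv s t) f = ev s (fun x => ev t (fun y => f (x + y))).
Proof.
rewrite /ev /conv big_allpairs_dep /=; apply: eq_bigr => p _.
by rewrite mulr_sumr; apply: eq_bigr => q _; rewrite mulrA.
Qed.

Lemma refl_conv r (s t : meas r) : refl (conv s t) = conv (refl s) (refl t).
Proof.
rewrite /refl /conv map_allpairs allpairs_mapl allpairs_mapr.
by apply: eq_allpairs => // p q; rewrite opprD.
Qed.

Lemma refl_bern_sum r (Fs : seq (rat * 'rV[int]_r)) :
  refl (bern_sum Fs) = bern_sum [seq (f.1, - f.2) | f <- Fs].
Proof.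
by elim: Fs => [|f Fs IH] /=; rewrite ?refl_conv ?IH /= /refl /= ?oppr0.
Qed.

(** Congruence modulo ['X^M], the form in which identities between exponential generating functions
    are used. *)
Definition teq (M : nat) (p q : {poly rat}) := forall k, (k < M)%N -> p`_k = q`_k.

Lemma teqM M p p' q q' : teq M p p' -> teq M q q' -> teq M (p * q) (p' * q').
Proof.
move=> pp qq k kM; rewrite !coefM; apply: eq_bigr => j _.
rewrite pp ?qq //; first exact: leq_ltn_trans (leq_subr _ _) kM.
by apply: leq_ltn_trans kM; rewrite -ltnS.
Qed.

Lemma teqD M p p' q q' : teq M p p' -> teq M q q' -> teq M (p + q) (p' + q').
Proof. by move=> pp qq k kM; rewrite !coefD pp ?qq. Qed.

Lemma teq_trans M p q s : teq M p q -> teq M q s -> teq M p s.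
Proof. by move=> H K k kM; rewrite H // K. Qed.

Lemma teq_sym M p q : teq M p q -> teq M q p.
Proof. by move=> H k kM; rewrite H. Qed.

Lemma teqW M p q : teq M.+1 p q -> teq M p q.
Proof. by move=> H k kM; rewrite H // ltnS ltnW. Qed.

Lemma teq_deriv M p q : teq M.+1 p q -> teq M p^`() q^`().
Proof. by move=> H k kM; rewrite !coef_deriv H. Qed.

(** The equation [G' = psi * G] determines each coefficient from the previous ones, and integration
    gains one order. *)
Lemma teq_ode M G H psi phi : teq M psi phi -> teq M G^`() (psi * G) ->
  teq M H^`() (phi * H) -> G`_0 = H`_0 -> teq M.+1 G H.
Proof.
move=> pp HG HH G0; elim/ltn_ind => -[|k] IH kM //.
have := HG k kM; have := HH k kM; rewrite !coef_deriv !coefM => h g.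
have : G`_k.+1 *+ k.+1 = H`_k.+1 *+ k.+1.
  rewrite g h; apply: eq_bigr => j _; congr (_ * _).
    by apply: pp; apply: leq_trans (ltn_ord j) _.
  by apply: IH; rewrite ltnS ?leq_subr //; apply: leq_trans (leq_subr _ _) (ltnW (kM : (k < M)%N)).
by move/eqP; rewrite -subr_eq0 -mulrnBl mulrn_eq0 subr_eq0 => /eqP.
Qed.

(* [exp (z X)] and, below, moment generating functions and their logarithmic derivatives,
   all truncated at order [M]. *)
Definition texp M (z : int) : {poly rat} := \poly_(k < M) (z%:~R ^+ k / k`!%:R).

Lemma texpD M y z : teq M (texp M (y + z)) (texp M y * texp M z).
Proof.
move=> k kM; rewrite coefM coef_poly kM rmorphD addrC exprDn mulr_suml.
apply: eq_bigr => j _.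
have jk : (j <= k)%N by rewrite -ltnS.
rewrite !coef_poly (leq_ltn_trans jk kM) (leq_ltn_trans (leq_subr _ _) kM).
rewrite -mulr_natl -(bin_fact jk) !natrM.
have f0 n : n`!%:R != 0 :> rat by rewrite pnatr_eq0 -lt0n fact_gt0.
have : 'C(k, j)%:R != 0 :> rat by rewrite pnatr_eq0 -lt0n bin_gt0.
move=> c0; field; by rewrite !f0 c0.
Qed.

Definition tmgf r M (s : meas r) (i : 'I_r) : {poly rat} := \sum_(p <- s) p.1 *: texp M (p.2 0 i).

Lemma coef_mg r M (s : meas r) i k : (k < M)%N ->
  (tmgf M s i)`_k = ev s (fun x => (x 0 i)%:~R ^+ k) / k`!%:R.
Proof.
move=> kM; rewrite /tmgf coef_sum /ev mulr_suml; apply: eq_bigr => p _.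
by rewrite coefZ coef_poly kM mulrA.
Qed.

Lemma tmgf_conv r M (s t : meas r) i : teq M (tmgf M (conv s t) i) (tmgf M s i * tmgf M t i).
Proof.
move=> k kM; rewrite /tmgf /conv big_allpairs_dep /= mulr_suml !coef_sum.
apply: eq_bigr => p _; rewrite mulr_sumr !coef_sum; apply: eq_bigr => q _.
by rewrite mxE -scalerAl -scalerAr scalerA !coefZ (texpD _ _ kM).
Qed.

Definition tlogder M (u : rat) (z : int) : {poly rat} :=
  \poly_(k < M) ((bcum k).[u] * z%:~R ^+ k.+1 / k`!%:R).

(** Coefficient by coefficient this is [bcum_rec], rescaled by powers of the coordinate. *)
Lemma tmgf_bern_law r M (f : rat * 'rV[int]_r) i :
  teq M (tmgf M.+1 (bern_law f) i)^`() (tlogder M f.1 (f.2 0 i) * tmgf M.+1 (bern_law f) i).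
Proof.
have -> : tmgf M.+1 (bern_law f) i = (1 - f.1)%:P + f.1 *: texp M.+1 (f.2 0 i).
  rewrite /tmgf /bern_law big_cons big_seq1 /= mxE; congr (_ + _).
  apply/polyP => k; rewrite coefZ coefC coef_poly expr0n.
  by case: k => [|k] /=; rewrite ?divr1 ?mulr1 // mul0r if_same mulr0.
move=> n nM; set u := f.1; set z := f.2 0 i.
rewrite coef_deriv coefD coefC coefZ coef_poly ltnS nM add0r.
rewrite mulrDr coefD coefMC -scalerAr coefZ [(tlogder M u z)`_n]coef_poly nM.
have f0 k : k`!%:R != 0 :> rat by rewrite pnatr_eq0 -lt0n fact_gt0.
have -> : (tlogder M u z * texp M.+1 z)`_n = z%:~R ^+ n.+1 / n`!%:R * \sum_(k < n.+1) (bcum k).[u] *+ 'C(n, k).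
  rewrite coefM mulr_sumr; apply: eq_bigr => k _.
  have kn : (k <= n)%N by rewrite -ltnS.
  rewrite !coef_poly (leq_ltn_trans kn nM) (@leq_ltn_trans n) ?leq_subr ?ltnS ?(ltnW nM) //.
  rewrite -mulr_natl -(bin_fact kn) !natrM.
  have : 'C(n, k)%:R != 0 :> rat by rewrite pnatr_eq0 -lt0n bin_gt0.
  have -> : z%:~R ^+ n.+1 = z%:~R ^+ k.+1 * z%:~R ^+ (n - k) :> rat by rewrite -exprD addSn subnKC.
  by move=> c0; field; rewrite !f0 c0.
set S := \sum_(k < n.+1) _.
have E : u = (1 - u) * (bcum n).[u] + u * S.
  rewrite -[LHS]hornerX (bcum_rec n) hornerD !hornerM hornerD hornerN hornerX hornerC horner_sum.
  by rewrite /S; under eq_bigr do rewrite hornerMn.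
have n1 : n.+1%:R != 0 :> rat by rewrite pnatr_eq0.
have -> : u * (z%:~R ^+ n.+1 / (n.+1)`!%:R) *+ n.+1 = u * (z%:~R ^+ n.+1 / n`!%:R) :> rat.
  by rewrite factS natrM -[LHS]mulr_natl; move: n1; move: (n.+1%:R : rat) => c n1; field; rewrite n1 f0.
rewrite {1}E; field; exact: f0.
Qed.

(** Convolution multiplies generating functions, so logarithmic derivatives add up. *)
Lemma tmgf_bern_sum r M (Fs : seq (rat * 'rV[int]_r)) i :
  teq M (tmgf M.+1 (bern_sum Fs) i)^`()
        ((\sum_(f <- Fs) tlogder M f.1 (f.2 0 i)) * tmgf M.+1 (bern_sum Fs) i).
Proof.
elim: Fs => [|f Fs IH] /=.
  rewrite big_nil mul0r /tmgf big_seq1 /= mxE scale1r.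
  by move=> k kM; rewrite coef_deriv coef_poly coef0 expr0n mul0r if_same mul0rn.
have H := tmgf_conv (M := M.+1) (bern_law f) (bern_sum Fs) i.
apply: teq_trans (teq_deriv H) _; rewrite derivM big_cons mulrDl.
apply: (@teq_trans _ _ (tlogder M f.1 (f.2 0 i) * (tmgf M.+1 (bern_law f) i * tmgf M.+1 (bern_sum Fs) i)
   + (\sum_(f <- Fs) tlogder M f.1 (f.2 0 i)) * (tmgf M.+1 (bern_law f) i * tmgf M.+1 (bern_sum Fs) i))).
  apply: teqD; first by rewrite mulrA; apply: teqM => //; apply: tmgf_bern_law.
  by rewrite mulrCA; apply: teqM.
by apply: teqD; apply: teqM => //; apply/teqW/teq_sym.
Qed.

Lemma bern_sum_cat r (F1 F2 : seq (rat * 'rV[int]_r)) i M :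
  teq M (tmgf M (conv (bern_sum F1) (bern_sum F2)) i) (tmgf M (bern_sum (F1 ++ F2)) i).
Proof.
elim: F1 => [|f F1 IH] /=.
  move=> k _; congr _`_k; rewrite /tmgf /conv big_allpairs_dep big_seq1 /=.
  under eq_bigr do rewrite mul1r add0r.
  by [].
apply: teq_trans (tmgf_conv _ _ _) _; apply: teq_trans (teq_sym (tmgf_conv _ _ _)).
apply: (@teq_trans _ _ (tmgf M (bern_law f) i * tmgf M (bern_sum F1) i * tmgf M (bern_sum F2) i)).
  by apply: teqM => //; apply: tmgf_conv.
rewrite -mulrA; apply: teqM => //; apply: teq_trans IH; apply: teq_sym; exact: tmgf_conv.
Qed.

(** The summands are the products of the entries of [one_dim] with the vectors of [equal_variance],
    and [B] is symmetrised. It suffices to compare the cumulants of the columns, since by [teq_ode]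
    they determine the moments. *)
Lemma matched_moments r M (a : 'I_r -> int) (X0 : seq 'rV[int]_r) :
  (forall i, `|a i| < \sum_(j < r | j != i) `|a j|) -> all (orth a) X0 ->
  exists Fs : seq (rat * 'rV[int]_r),
  [/\ all (fun f => [&& 0 < f.1, f.1 < 1 & orth a f.2]) Fs,
      forall x, x \in X0 -> (2^-1, x) \in Fs &
      forall i j k, (k <= M)%N ->
        let B := conv (bern_sum Fs) (refl (bern_sum Fs)) in
        ev B (fun x => (x 0 i)%:~R ^+ k) = ev B (fun x => (x 0 j)%:~R ^+ k)].
Proof.
move=> ha oX0.
have [Xs [oXs sXs vXs]] := equal_variance ha oX0.
have [l [l1 al lP]] := one_dim M.
pose Fs := [seq (p.1, x *+ p.2) | p <- l, x <- Xs].
exists Fs; split.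
- apply/allP => _ /allpairsP[[p x] /= [pl xX ->]] /=.
  by have /and3P[-> -> _] := allP al _ pl; rewrite orthMn // (allP oXs).
- by move=> x /sXs xX; apply/allpairsP; exists ((2^-1, 1%N), x).
move=> i j k kM; rewrite refl_bern_sum; set Fn := map _ Fs; move=> B.
have E i' : ev B (fun x => (x 0 i')%:~R ^+ k) = (tmgf M.+1 (bern_sum (Fs ++ Fn)) i')`_k * k`!%:R.
  rewrite -bern_sum_cat // coef_mg // divfK // pnatr_eq0 -lt0n; exact: fact_gt0.
rewrite !E; congr (_ * _); move: k kM {E}.
suff: teq M.+1 (tmgf M.+1 (bern_sum (Fs ++ Fn)) i) (tmgf M.+1 (bern_sum (Fs ++ Fn)) j).
  by move=> H k kM; apply: H.
apply: (teq_ode _ (@tmgf_bern_sum _ _ _ _) (@tmgf_bern_sum _ _ _ _)); last first.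
  by rewrite !coef_mg.
move=> n nM; rewrite !coef_sum !big_cat /= !big_map /=.
have {}E i' : \sum_(f <- Fs) (tlogder M f.1 (f.2 0 i'))`_n + \sum_(f <- Fs) (tlogder M f.1 ((- f.2) 0 i'))`_n
   = (1 + (-1) ^+ n.+1) / n`!%:R * ((\sum_(p <- l) (bcum n).[p.1] * p.2%:R ^+ n.+1) * \sum_(x <- Xs) (x 0 i')%:~R ^+ n.+1).
  rewrite mulr_suml mulr_sumr -big_split /= big_allpairs_dep /=.
  apply: eq_bigr => p _; rewrite !mulr_sumr; apply: eq_bigr => x _.
  rewrite /tlogder !coef_poly nM !mxE mulmxnE rmorphN /= rmorphMn /= -mulr_natr.
  by rewrite -mulN1r !exprMn; ring.
(* The cumulant order is one more than the index. Odd orders vanish by symmetry, order 2 agrees by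
   [vXs], and the even orders from 4 on vanish by the choice of [l]. *)
rewrite !E; case: n nM {E} => [|[|n]] nM.
- by rewrite expr1 addrN !mul0r.
- by rewrite (vXs i j).
have [/eqP on|on] := boolP (odd n); last first.
  have -> : (-1) ^+ n.+3 = -1 :> rat by rewrite -signr_odd /= negbK on expr1.
  by rewrite subrr !mul0r.
have -> : n.+2 = ((n./2).*2 + 3)%N by lia.
have -> : ((n./2).*2 + 3).+1 = ((n./2).*2 + 4)%N by lia.
by rewrite lP ?mul0r //; lia.
Qed.

(** * Smoothing in the l1 norm *)

Definition norm1 (p : {poly rat}) : rat := \sum_(j < size p) `|p`_j|.

Lemma norm1_wide n (p : {poly rat}) : (size p <= n)%N -> norm1 p = \sum_(j < n) `|p`_j|.
Proof.
move=> pn; rewrite /norm1 (big_ord_widen n (fun j => `|p`_j|)) // big_mkcond.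
apply: eq_bigr => j _; case: ifP => // /negbT; rewrite -leqNgt => h.
by rewrite nth_default ?normr0.
Qed.

Lemma norm1_ge0 (p : {poly rat}) : 0 <= norm1 p. Proof. exact: sumr_ge0. Qed.

Lemma norm1_coef (p : {poly rat}) j : `|p`_j| <= norm1 p.
Proof.
have [h|h] := ltnP j (size p); last by rewrite nth_default // normr0 norm1_ge0.
by rewrite /norm1 (bigD1 (Ordinal h)) //= lerDl sumr_ge0.
Qed.

Lemma norm1D (p q : {poly rat}) : norm1 (p + q) <= norm1 p + norm1 q.
Proof.
have sz := size_polyD p q.
rewrite !(@norm1_wide (maxn (size p) (size q))) ?leq_maxl ?leq_maxr // -big_split /=.
by apply: ler_sum => j _; rewrite coefD ler_normD.
Qed.

Lemma norm1_0 : norm1 0 = 0. Proof. by rewrite /norm1 size_poly0 big_ord0. Qed.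

Lemma norm1_sum (I : Type) (s : seq I) (F : I -> {poly rat}) :
  norm1 (\sum_(i <- s) F i) <= \sum_(i <- s) norm1 (F i).
Proof.
elim: s => [|i s IH]; first by rewrite !big_nil norm1_0.
by rewrite !big_cons; apply: le_trans (norm1D _ _) _; rewrite lerD2l.
Qed.

Lemma norm1Z c (p : {poly rat}) : norm1 (c *: p) = `|c| * norm1 p.
Proof.
rewrite (@norm1_wide (size p)) ?size_scale_leq // /norm1 mulr_sumr.
by apply: eq_bigr => j _; rewrite coefZ normrM.
Qed.

Lemma norm1XnM n (p : {poly rat}) : norm1 ('X^n * p) = norm1 p.
Proof.
rewrite (@norm1_wide (n + size p)); last by rewrite (leq_trans (size_polyMleq _ _)) ?size_polyXn.
rewrite big_split_ord /= big1 ?add0r.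
  by apply: eq_bigr => j _; rewrite coefXnM ltnNge leq_addr /= addKn.
by move=> j _; rewrite coefXnM ltn_ord normr0.
Qed.

Lemma norm1M (p q : {poly rat}) : norm1 (p * q) <= norm1 p * norm1 q.
Proof.
have pE : p * q = \sum_(j < size p) p`_j *: ('X^j * q).
  rewrite -{1}[p]coefK poly_def mulr_suml; apply: eq_bigr => j _.
  by rewrite scalerAl.
rewrite pE; apply: le_trans (norm1_sum _ _) _.
by rewrite [norm1 p]/norm1 mulr_suml; apply: ler_sum => j _; rewrite norm1Z norm1XnM.
Qed.

Lemma norm1_prod (I : eqType) (s : seq I) (F : I -> {poly rat}) :
  (forall i, i \in s -> norm1 (F i) <= 1) -> norm1 (\prod_(i <- s) F i) <= 1.
Proof.
elim: s => [_|i s IH H]; first by rewrite big_nil /norm1 size_poly1 big_ord1 coef1 normr1.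
rewrite big_cons; apply: le_trans (norm1M _ _) _.
rewrite -[leRHS]mulr1 ler_pM ?norm1_ge0 //; first by rewrite H ?mem_head.
by apply: IH => j js; rewrite H // in_cons js orbT.
Qed.

Lemma norm1X (p : {poly rat}) n c : norm1 p <= c -> norm1 (p ^+ n) <= c ^+ n.
Proof.
move=> pc; elim: n => [|n IH]; first by rewrite !expr0 /norm1 size_poly1 big_ord1 coef1 normr1.
by rewrite !exprS; apply: le_trans (norm1M _ _) _; rewrite ler_pM ?norm1_ge0.
Qed.

(** The generating polynomial of a fair step in 0 or 1. *)
Definition half_step : {poly rat} := 2^-1 *: (1 + 'X).

Lemma norm1_half_step : norm1 half_step <= 1.
Proof.
rewrite /half_step norm1Z; apply: (@le_trans _ _ (2^-1 * (1 + 1))); last by rewrite mulVf.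
rewrite ger0_norm // ler_wpM2l //; apply: le_trans (norm1D _ _) _.
by rewrite -['X]expr1 -['X^1]mulr1 norm1XnM /norm1 size_poly1 big_ord1 coef1 normr1.
Qed.

(** Multiplies the coefficient of ['X^j] by [2 j - m], twice the deviation of [j] from the mean of
    [m] fair steps. *)
Definition Dm m (p : {poly rat}) : {poly rat} := 2 *: ('X * p^`()) - m%:R *: p.

Lemma coef_Dm m p j : (Dm m p)`_j = (j%:R *+ 2 - m%:R) * p`_j.
Proof.
rewrite /Dm coefB !coefZ coefXM coef_deriv; case: j => [|j] /=; first by rewrite mul0rn; ring.
by rewrite -[p`_j.+1 *+ _]mulr_natl; ring.
Qed.

Lemma Dm_pow m : Dm m.+1 ((1 + 'X) ^+ m.+1) = m.+1%:R *: (('X - 1) * (1 + 'X) ^+ m).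
Proof.
rewrite /Dm deriv_exp derivD derivC derivX add0r mul1r /= exprS -!mul_polyC.
rewrite -[(1 + 'X) ^+ m *+ _]mulr_natl !polyC_natr.
set y := (1 + 'X) ^+ m; ring.
Qed.

(** By [Dm_pow], the coefficients of [('X - 1) * (1 + 'X) ^ m] are those of [(1 + 'X) ^ m.+1] times
    [(2 j - m.+1) / m.+1]. The norm is thus a mean absolute deviation of a binomial law, controlled
    by its standard deviation, and the deviation [k] corresponds to [m.+1 = k ^ 2]. *)
Lemma norm1_diff k : (0 < k)%N -> norm1 (('X - 1) * half_step ^+ (k ^ 2)) <= 2 / k%:R.
Proof.
move=> k0; have [m mE] : exists m, (k ^ 2 = m.+1)%N by exists (k ^ 2).-1; rewrite prednK ?expn_gt0 ?k0.
rewrite mE exprSr mulrA; apply: le_trans (norm1M _ _) _.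
rewrite -[leRHS]mulr1 ler_pM ?norm1_ge0 ?norm1_half_step //.
rewrite /half_step exprZn -scalerAr norm1Z normrX ger0_norm //.
have k0' : 0 < k%:R :> rat by rewrite ltr0n.
have m0 : m.+1%:R = k%:R ^+ 2 :> rat by rewrite -mE natrX.
have mn0 : m.+1%:R != 0 :> rat by rewrite pnatr_eq0.
suff H : m.+1%:R * norm1 (('X - 1) * (1 + 'X) ^+ m) <= k%:R * 2 ^+ m.+1.
  rewrite exprVn mulrC ler_pdivrMr ?exprn_gt0 //.
  move: H; rewrite m0 [2 ^+ m.+1]exprS => H.
  rewrite -(@ler_pM2l _ (k%:R ^+ 2)) ?exprn_gt0 //; apply: le_trans H _.
  by rewrite le_eqVlt; apply/orP; left; apply/eqP; field; rewrite gt_eqF.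
pose f : {poly rat} := (1 + 'X) ^+ m.+1.
have szX : size (1 + 'X : {poly rat}) = 2%N.
  by rewrite addrC -polyC1 size_XaddC.
have szf : (size f <= m.+2)%N.
  by rewrite (leq_trans (size_poly_exp_leq _ _)) // szX mul1n.
have fj j : f`_j = 'C(m.+1, j)%:R.
  rewrite /f exprDn coef_sum; under eq_bigr do rewrite expr1n mul1r coefMn coefXn.
  have [h|h] := ltnP j m.+2.
    rewrite (bigD1 (Ordinal h)) //= eqxx big1 ?addr0 // => i /eqP ij.
    by case: eqP => [ji|_]; rewrite ?mul0rn //; case: ij; apply: val_inj.
  rewrite bin_small // big1 // => i _; case: eqP => [ji|_]; rewrite ?mul0rn //.
  by have := ltn_ord i; lia.
rewrite -[X in X * _](ger0_norm (ler0n _ _)) -norm1Z -Dm_pow -/f.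
have szD (p : {poly rat}) : (size p <= m.+2)%N -> (size (Dm m.+1 p) <= m.+2)%N.
  move=> sp; apply/leq_sizeP => j mj; rewrite coef_Dm.
  by move/leq_sizeP: sp => ->; rewrite ?mulr0.
rewrite (@norm1_wide m.+2) ?szD //.
have V : \sum_(j < m.+2) (j%:R *+ 2 - m.+1%:R) ^+ 2 * f`_j = m.+1%:R * 2 ^+ m.+1.
  have -> : \sum_(j < m.+2) (j%:R *+ 2 - m.+1%:R) ^+ 2 * f`_j = (Dm m.+1 (Dm m.+1 f)).[1].
    rewrite (@horner_coef_wide _ m.+2) ?szD //; apply: eq_bigr => j _.
    by rewrite !coef_Dm expr1n mulr1 expr2 mulrA.
  rewrite Dm_pow /Dm; set g := _ * (1 + 'X) ^+ m.
  have g1 : g.[1] = 0 by rewrite /g hornerM hornerD hornerN hornerX hornerC subrr mul0r.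
  have dg1 : g^`().[1] = 2 ^+ m.
    rewrite /g derivM derivB derivX derivC subr0 mul1r hornerD hornerM hornerD hornerN hornerX hornerC subrr mul0r addr0.
    by rewrite horner_exp hornerD hornerX hornerC.
  rewrite derivZ hornerD hornerN !hornerZ hornerM hornerX hornerZ g1 dg1 exprS.
  by ring.
have F : \sum_(j < m.+2) f`_j = 2 ^+ m.+1.
  have -> : \sum_(j < m.+2) f`_j = f.[1].
    by rewrite (@horner_coef_wide _ m.+2) //; apply: eq_bigr => j _; rewrite expr1n mulr1.
  by rewrite horner_exp hornerD hornerX hornerC.
(* The inequality [|x| <= (x ^ 2 / k + k) / 2] for each deviation [x], followed by the variance [V]
   and the total mass [F]. *)
apply: (@le_trans _ _ (\sum_(j < m.+2) ((j%:R *+ 2 - m.+1%:R) ^+ 2 * f`_j / k%:R + k%:R * f`_j) / 2)).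
  apply: ler_sum => j _; rewrite coef_Dm normrM [`|f`_j|]ger0_norm ?fj ?ler0n //.
  set c : rat := 'C(_, _)%:R; have c0 : 0 <= c by rewrite ler0n.
  set x := _ - _.
  have -> : (x ^+ 2 * c / k%:R + k%:R * c) / 2 = (`|x| ^+ 2 / k%:R + k%:R) / 2 * c.
    by rewrite real_normK ?num_real //; field; rewrite gt_eqF.
  rewrite ler_wpM2r // -(@ler_pM2l _ (k%:R *+ 2)) ?mulrn_wgt0 //.
  have -> : k%:R *+ 2 * ((`|x| ^+ 2 / k%:R + k%:R) / 2) = `|x| ^+ 2 + k%:R ^+ 2 by field; rewrite gt_eqF.
  have := sqr_ge0 (`|x| - k%:R); nra.
rewrite -mulr_suml big_split /= -mulr_suml -mulr_sumr V F m0.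
by rewrite le_eqVlt; apply/orP; left; apply/eqP; field; rewrite gt_eqF.
Qed.

Lemma bin_poly k : exists2 Q : {poly rat}, (size Q <= k.+1)%N & forall n : nat, 'C(n, k)%:R = Q.[n%:R].
Proof.
elim: k => [|k [Q sQ QP]].
  by exists 1 => [|n]; rewrite ?size_poly1 // bin0 hornerC.
exists (k.+1%:R^-1 *: (Q * ('X - k%:R%:P))).
  apply: leq_trans (size_scale_leq _ _) _; apply: leq_trans (size_polyMleq _ _) _.
  by rewrite size_XsubC addn2.
move=> n; rewrite hornerZ hornerM hornerXsubC -QP.
have k0 : k.+1%:R != 0 :> rat by rewrite pnatr_eq0.
apply: (mulfI k0); rewrite mulVKf // -natrM mul_bin_left.
have [kn|nk] := leqP k n; first by rewrite natrM natrB // mulrC.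
by rewrite bin_small // muln0 mul0r.
Qed.

(** The coefficients of the polynomial in powers of ['X - 1] are its binomial moments. Binomial
    coefficients are polynomials in the upper index, so these moments vanish below [M] together with
    the power moments. *)
Lemma div_moments (l : seq (rat * int)) (K : int) M :
  (forall p, p \in l -> 0 <= p.2 + K) ->
  (forall k, (k < M)%N -> \sum_(p <- l) p.1 * p.2%:~R ^+ k = 0) ->
  exists e, \sum_(p <- l) p.1 *: 'X^(absz (p.2 + K)) = ('X - 1) ^+ M * e.
Proof.
move=> lK lM; set p := \sum_(p <- l) _.
pose p1 := p \Po ('X + 1).
have p1E k : p1`_k = \sum_(x <- l) x.1 * 'C(absz (x.2 + K), k)%:R.
  rewrite /p1 /p raddf_sum /= coef_sum; apply: eq_bigr => x _.
  rewrite comp_polyZ comp_Xn_poly coefZ; congr (_ * _).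
  set n := absz _; rewrite addrC exprDn coef_sum; under eq_bigr do rewrite expr1n mul1r coefMn coefXn.
  have [h|h] := ltnP k n.+1.
    rewrite (bigD1 (Ordinal h)) //= eqxx big1 ?addr0 // => i /eqP ij.
    by case: eqP => [ji|_]; rewrite ?mul0rn //; case: ij; apply: val_inj.
  rewrite bin_small // big1 // => i _; case: eqP => [ji|_]; rewrite ?mul0rn //.
  by have := ltn_ord i; lia.
have p10 k : (k < M)%N -> p1`_k = 0.
  move=> kM; have [Q sQ QP] := bin_poly k.
  pose Q1 := Q \Po ('X + K%:~R%:P).
  have sQ1 : (size Q1 <= k.+1)%N.
    by rewrite /Q1 size_comp_poly2 // size_XaddC.
  have E x : x \in l -> x.1 * 'C(absz (x.2 + K), k)%:R = \sum_(j < k.+1) Q1`_j * (x.1 * x.2%:~R ^+ j).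
    move=> xl; have -> : 'C(absz (x.2 + K), k)%:R = Q1.[x.2%:~R].
      rewrite QP /Q1 horner_comp !hornerE -rmorphD; congr Q.[_].
      by rewrite -[LHS]/((absz (x.2 + K))%:Z%:~R) gez0_abs // lK.
    rewrite (horner_coef_wide _ sQ1) mulr_sumr; apply: eq_bigr => j _; ring.
  rewrite p1E (eq_big_seq _ E) exchange_big /= big1 // => j _.
  by rewrite -mulr_sumr lM ?mulr0 // (leq_ltn_trans _ kM) // -ltnS.
have p1D : p1 = drop_poly M p1 * 'X^M.
  rewrite -{1}[p1](poly_take_drop M); apply/eqP; rewrite -subr_eq0 addrK; apply/eqP.
  by apply/polyP => k; rewrite coef_take_poly coef0; case: ifP => // /p10.
exists (drop_poly M p1 \Po ('X - 1)).
have -> : p = p1 \Po ('X - 1).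
  by rewrite /p1 -comp_polyA comp_polyD comp_polyX -polyC1 comp_polyC subrK comp_polyXr.
by rewrite p1D comp_polyM comp_Xn_poly mulrC -p1D.
Qed.

(** * Random walks on the lattice *)

Definition nonneg r (s : meas r) := all (fun p => 0 <= p.1) s.
Definition supported r (a : 'I_r -> int) (s : meas r) := all (fun p => orth a p.2) s.
Definition bounded r (K : nat) (s : meas r) :=
  all (fun p : rat * 'rV[int]_r => [forall i : 'I_r, `|p.2 0 i| <= K%:Z]) s.
Definition cmass r (s : meas r) (i : 'I_r) (n : int) := ev s (fun x => (x 0 i == n)%:R).
Definition pmass r (s : meas r) (x : 'rV[int]_r) := ev s (fun y => (y == x)%:R).
(** The generating polynomial of the law of column [i], shifted by [K] so that the exponents are
    nonnegative on measures bounded by [K]. *)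
Definition pol r (K : nat) (s : meas r) (i : 'I_r) : {poly rat} :=
  \sum_(p <- s) p.1 *: 'X^(absz (p.2 0 i + K%:Z)).
Definition cpow r (s : meas r) (n : nat) : meas r := iter n (conv s) [:: (1, 0)].

Lemma all_conv r (P Q S : pred (rat * 'rV[int]_r)) (s t : meas r) :
  (forall p q, P p -> Q q -> S (p.1 * q.1, p.2 + q.2)) -> all P s -> all Q t -> all S (conv s t).
Proof.
move=> H /allP sP /allP tQ; apply/allP => _ /allpairsP[[p q] /= [ps qt ->]].
by apply: H; [apply: sP | apply: tQ].
Qed.

Lemma nonneg_conv r (s t : meas r) : nonneg s -> nonneg t -> nonneg (conv s t).
Proof. by apply: all_conv => p q /= p0 q0; rewrite mulr_ge0. Qed.

Lemma supported_conv r (a : 'I_r -> int) s t : supported a s -> supported a t -> supported a (conv s t).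
Proof. by apply: all_conv => p q /=; apply: orthD. Qed.

Lemma boundedP r K (s : meas r) : reflect (forall p, p \in s -> forall i, `|p.2 0 i| <= K%:Z) (bounded K s).
Proof.
apply: (iffP allP) => H p /H; first by move/forallP.
by move=> h; apply/forallP.
Qed.

Lemma bounded_conv r K K' (s t : meas r) : bounded K s -> bounded K' t -> bounded (K + K') (conv s t).
Proof.
apply: all_conv => p q /= /forallP pK /forallP qK; apply/forallP => i.
rewrite mxE PoszD; apply: le_trans (ler_normD _ _) _; exact: lerD.
Qed.

Lemma all_refl r (P Q : pred (rat * 'rV[int]_r)) (s : meas r) :
  (forall p, P p -> Q (p.1, - p.2)) -> all P s -> all Q (refl s).
Proof. by move=> H /allP sP; apply/allP => _ /mapP[p /sP Pp ->]; apply: H. Qed.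

Lemma nonneg_refl r (s : meas r) : nonneg s -> nonneg (refl s).
Proof. by apply: all_refl. Qed.

Lemma supported_refl r (a : 'I_r -> int) s : supported a s -> supported a (refl s).
Proof. by apply: all_refl => p; apply: orthN. Qed.

Lemma bounded_refl r K (s : meas r) : bounded K s -> bounded K (refl s).
Proof. by apply: all_refl => p /forallP pK; apply/forallP => i; rewrite mxE normrN. Qed.

Lemma bounded_unit r : bounded 0 [:: (1 : rat, 0 : 'rV[int]_r)].
Proof. by apply/boundedP => p; rewrite inE => /eqP-> i /=; rewrite mxE normr0. Qed.

Lemma nonneg_cpow r (s : meas r) n : nonneg s -> nonneg (cpow s n).
Proof. by move=> s0; elim: n => //= n IH; apply: nonneg_conv. Qed.

Lemma supported_unit r (a : 'I_r -> int) : supported a [:: (1, 0)].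
Proof. by rewrite /supported /= orth0. Qed.

Lemma supported_cpow r (a : 'I_r -> int) s n : supported a s -> supported a (cpow s n).
Proof. by move=> s0; elim: n => [|n IH] /=; [apply: supported_unit|apply: supported_conv]. Qed.

Lemma bounded_cpow r K (s : meas r) n : bounded K s -> bounded (n * K) (cpow s n).
Proof.
move=> sK; elim: n => [|n IH] /=; first exact: bounded_unit.
by rewrite mulSn; apply: bounded_conv.
Qed.

Lemma bounded_bern_law r K (f : rat * 'rV[int]_r) :
  [forall i, `|f.2 0 i| <= K%:Z] -> bounded K (bern_law f).
Proof.
move=> /forallP fK; apply/boundedP => p; rewrite !inE => /orP[] /eqP -> i //=.
by rewrite mxE normr0.
Qed.

Lemma bounded_bern_sum r K (Fs : seq (rat * 'rV[int]_r)) :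
  bounded K Fs -> bounded (size Fs * K) (bern_sum Fs).
Proof.
elim: Fs => [|f Fs IH] /=; first by move=> _; exact: bounded_unit.
by case/andP => fK FK; rewrite mulSn; apply: bounded_conv (IH FK); apply: bounded_bern_law.
Qed.

Lemma nonneg_bern_sum r (Fs : seq (rat * 'rV[int]_r)) :
  all (fun f => (0 < f.1) && (f.1 < 1)) Fs -> nonneg (bern_sum Fs).
Proof.
elim: Fs => [|f Fs IH] //= /andP[/andP[f0 f1] FK]; apply: nonneg_conv (IH FK).
by rewrite /nonneg /= subr_ge0 (ltW f1) (ltW f0).
Qed.

Lemma supported_bern_sum r (a : 'I_r -> int) (Fs : seq (rat * 'rV[int]_r)) :
  supported a Fs -> supported a (bern_sum Fs).
Proof.
elim: Fs => [|f Fs IH] /=; first by move=> _; exact: supported_unit.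
by move=> /andP[fo FK]; apply: supported_conv (IH FK); rewrite /supported /= orth0 fo.
Qed.

Lemma pol_conv r K K' (s t : meas r) i : bounded K s -> bounded K' t ->
  pol (K + K') (conv s t) i = pol K s i * pol K' t i.
Proof.
move=> /boundedP sK /boundedP tK; rewrite /pol /conv big_allpairs_dep /= mulr_suml.
apply: eq_big_seq => p ps; rewrite mulr_sumr; apply: eq_big_seq => q qt.
rewrite -scalerAl -scalerAr scalerA -exprD mxE; congr (_ *: 'X^_).
have h1 := sK _ ps i; have h2 := tK _ qt i. move: h1 h2; move: (p.2 0 i) (q.2 0 i) => x y h1 h2; lia.
Qed.

Lemma pol_cpow r K (s : meas r) n i : bounded K s -> pol (n * K) (cpow s n) i = pol K s i ^+ n.
Proof.
move=> sK; elim: n => [|n IH] /=; first by rewrite /pol big_seq1 /= mxE scale1r.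
by rewrite exprS mulSn pol_conv ?IH // bounded_cpow.
Qed.

Lemma pol_bern_sum r K (Fs : seq (rat * 'rV[int]_r)) i : bounded K Fs ->
  pol (size Fs * K) (bern_sum Fs) i = \prod_(f <- Fs) pol K (bern_law f) i.
Proof.
elim: Fs => [|f Fs IH] /=; first by rewrite big_nil /pol big_seq1 /= mxE scale1r.
case/andP => fK FK; rewrite mulSn pol_conv ?IH ?big_cons //; first exact: bounded_bern_law.
exact: bounded_bern_sum.
Qed.

Lemma coef_pol r K (s : meas r) i (n : int) : bounded K s -> `|n| <= K%:Z ->
  (pol K s i)`_(absz (n + K%:Z)) = cmass s i n.
Proof.
move=> /boundedP sK nK; rewrite /pol coef_sum /cmass /ev; apply: eq_big_seq => p ps.
rewrite coefZ coefXn; congr (_ * _).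
have := sK _ ps i; move: (p.2 0 i) => x h; congr ((nat_of_bool _)%:R); move: nK.
by move=> nK; apply/idP/idP => /eqP h2; apply/eqP; lia.
Qed.

Lemma cmass_out r K (s : meas r) i (n : int) : bounded K s -> K%:Z < `|n| -> cmass s i n = 0.
Proof.
move=> /boundedP sK nK; rewrite /cmass /ev big_seq big1 // => p ps.
have := sK _ ps i; case: eqP => [->|_]; last by rewrite mulr0.
by rewrite leNgt nK.
Qed.

Lemma norm1_bern_law r K (f : rat * 'rV[int]_r) i : 0 < f.1 < 1 -> norm1 (pol K (bern_law f) i) <= 1.
Proof.
case/andP => f0 f1; rewrite /pol; apply: le_trans (norm1_sum _ _) _.
have norm1Xn n : norm1 'X^n = 1 by rewrite -['X^n]mulr1 norm1XnM /norm1 size_poly1 big_ord1 coef1 normr1.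
rewrite big_cons big_seq1 /= !norm1Z !norm1Xn !mulr1 !gtr0_norm ?subr_gt0 //.
by rewrite subrK.
Qed.

Lemma pol_half r K (x : 'rV[int]_r) i : [forall i, `|x 0 i| <= K%:Z] -> x 0 i = 1 ->
  pol K (bern_law (2^-1, x)) i = 'X^K * half_step.
Proof.
move=> _ xi; rewrite /pol /bern_law big_cons big_seq1 /= mxE xi /half_step add0r -scalerAr mulrDr mulr1.
have -> : 1 - 2^-1 = 2^-1 :> rat by rewrite -[X in X - _](@mulVf _ 2) //; lra.
by rewrite -scalerDr (_ : absz (1 + K%:Z) = K.+1) ?exprSr //; lia.
Qed.

(** The law of the difference of two independent [N]-step walks, which is also that of [N] steps of
    the symmetrised law in [matched_moments]. The first form serves the lower bound, the second the
    comparison of columns. *)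
Definition walk r (Fs : seq (rat * 'rV[int]_r)) (N : nat) : meas r :=
  conv (cpow (bern_sum Fs) N) (refl (cpow (bern_sum Fs) N)).

Lemma refl_cpow r (s : meas r) n : refl (cpow s n) = cpow (refl s) n.
Proof.
elim: n => [|n IH] /=; first by rewrite /refl /= oppr0.
by rewrite refl_conv IH.
Qed.

(* [half_step] divides all column polynomials, and ['X - 1] to the power [M] divides their
   differences; each factor ['X - 1] gains [2 / k] against [half_step ^+ (k ^ 2)]. *)
Lemma walk_cmass r (Fs : seq (rat * 'rV[int]_r)) M :
  all (fun f => (0 < f.1) && (f.1 < 1)) Fs ->
  (forall i : 'I_r, exists2 w : 'rV[int]_r, (2^-1, w) \in Fs & w 0 i = 1) ->
  (forall i j k, (k < M)%N ->
        let B := conv (bern_sum Fs) (refl (bern_sum Fs)) in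
        ev B (fun x => (x 0 i)%:~R ^+ k) = ev B (fun x => (x 0 j)%:~R ^+ k)) ->
  exists2 C : rat, 0 <= C & forall k, (0 < k)%N -> forall i j n,
    `|cmass (walk Fs (M * k ^ 2).+1) i n - cmass (walk Fs (M * k ^ 2).+1) j n|
      <= C * k%:R ^+ 2 / k%:R ^+ M.
Proof.
move=> F01 Fw FM.
have [K FK] : exists K, bounded K Fs.
  exists (\sum_(f <- Fs) \sum_(i < r) absz (f.2 0 i)%R)%N; apply/boundedP => f fF i.
  rewrite -abszE lez_nat (big_rem f) //= (bigD1 i) //=; lia.
pose K1 := (size Fs * K)%N; pose Bf := bern_sum Fs; pose Fn := [seq (f.1, - f.2) | f <- Fs].
have BK : bounded K1 Bf by apply: bounded_bern_sum.
have RK : bounded K1 (refl Bf) by apply: bounded_refl.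
have FnK : bounded K Fn by apply: bounded_refl FK.
have Fn01 : all (fun f => (0 < f.1) && (f.1 < 1)) Fn by apply: all_refl F01 => p.
pose B := conv Bf (refl Bf); pose P i := pol (K1 + K1) B i.
have PE i : P i = \prod_(f <- Fs) pol K (bern_law f) i * \prod_(f <- Fn) pol K (bern_law f) i.
  rewrite /P pol_conv // /Bf pol_bern_sum //; congr (_ * _).
  rewrite refl_bern_sum -/Fn; have -> : K1 = (size Fn * K)%N by rewrite /K1 /Fn size_map.
  exact: pol_bern_sum.
have /fin_all_exists[Ci CP] : forall i, exists c, P i = half_step * c /\ norm1 c <= 1.
  move=> i; have [w wF wi] := Fw i.
  (* The factor of [(2^-1, w)] is ['X^K * half_step], and the other factors have norm at most 1. *)
  exists ('X^K * (\prod_(f <- rem (2^-1, w) Fs) pol K (bern_law f) i * \prod_(f <- Fn) pol K (bern_law f) i)).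
  split.
    rewrite PE (big_rem (2^-1, w)) //= pol_half //; first by ring.
    by have /allP/(_ _ wF) := FK.
  rewrite norm1XnM; apply: le_trans (norm1M _ _) _; rewrite -[leRHS]mulr1 ler_pM ?norm1_ge0 //.
    by apply: norm1_prod => f /mem_rem fF; apply: norm1_bern_law; apply: (allP F01).
  by apply: norm1_prod => f fF; apply: norm1_bern_law; apply: (allP Fn01).
have /fin_all_exists[e eP] : forall ij : 'I_r * 'I_r, exists e, P ij.1 - P ij.2 = ('X - 1) ^+ M * e.
  move=> [i j] /=; have BKK : bounded (K1 + K1) B by apply: bounded_conv.
  have := @div_moments ([seq (p.1, p.2 0 i) | p : rat * 'rV[int]_r <- B] ++ [seq (- p.1, p.2 0 j) | p : rat * 'rV[int]_r <- B]) (K1 + K1)%N%:Z M.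
  move=> [||e eE].
  - move=> p; rewrite mem_cat => /orP[] /mapP[q qB ->] /=;
      have h := boundedP _ _ BKK q qB; [have := h i|have := h j]; [move: (q.2 0 i)|move: (q.2 0 j)] => x {}h; lia.
  - move=> k kM; rewrite big_cat !big_map /=.
    have := FM i j k kM; rewrite /= /ev -/Bf -/B => ->.
    by rewrite -big_split big1 //= => p _; rewrite mulNr subrr.
  exists e; rewrite -eE big_cat !big_map /= /P /pol; congr (_ + _).
  by rewrite -sumrN; apply: eq_bigr => p _; rewrite scaleNr.
pose C0 := \sum_ij norm1 (e ij).
have C00 : 0 <= C0 by apply: sumr_ge0 => ij _; apply: norm1_ge0.
exists (2 ^+ M * C0 * M.+1%:R); first by rewrite !mulr_ge0 // exprn_ge0.
move=> k k0 i j n; set N := (M * k ^ 2).+1.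
have k0' : 0 < k%:R :> rat by rewrite ltr0n.
have NK s : bounded K1 s -> bounded (N * K1) (cpow s N) by apply: bounded_cpow.
have WK : bounded (N * K1 + N * K1) (walk Fs N).
  by apply: bounded_conv; [|apply: bounded_refl]; apply: NK.
have R0 : 0 <= 2 ^+ M * C0 * M.+1%:R * k%:R ^+ 2 / k%:R ^+ M.
  by rewrite !mulr_ge0 ?invr_ge0 ?exprn_ge0.
have [nK|nK] := leP `|n| (N * K1 + N * K1)%N%:Z; last by rewrite !(cmass_out _ WK) // subrr normr0.
have WP l : pol (N * K1 + N * K1) (walk Fs N) l = P l ^+ N.
  rewrite /walk refl_cpow pol_conv ?NK // !pol_cpow // -exprMn.
  by rewrite /P pol_conv.
rewrite -!(coef_pol _ WK) // !WP -coefB; apply: le_trans (norm1_coef _ _) _.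
(* A difference of [N]-th powers is [P i - P j] times [N] products of [N - 1 = M * k ^ 2] column
   polynomials each. So every product contains [k ^ 2] factors [half_step] for each of the [M]
   factors ['X - 1], and the number of products accounts for the factor [k ^ 2] in the bound. *)
rewrite subrXX (eP (i, j)) /=.
have -> : \sum_(l < N) P i ^+ (N.-1 - l) * P j ^+ l =
   half_step ^+ (M * k ^ 2) * \sum_(l < N) Ci i ^+ (N.-1 - l) * Ci j ^+ l.
  rewrite mulr_sumr; apply: eq_bigr => l _.
  have lN : (l <= M * k ^ 2)%N by rewrite -ltnS.
  rewrite (CP i).1 (CP j).1 !exprMn -[in RHS](subnK lN) exprD /=; ring.
have -> : ('X - 1) ^+ M * e (i, j) * (half_step ^+ (M * k ^ 2) * \sum_(l < N) Ci i ^+ (N.-1 - l) * Ci j ^+ l)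
  = (('X - 1) * half_step ^+ (k ^ 2)) ^+ M * (e (i, j) * \sum_(l < N) Ci i ^+ (N.-1 - l) * Ci j ^+ l).
  by rewrite exprMn -exprM [(k ^ 2 * M)%N]mulnC; ring.
apply: le_trans (norm1M _ _) _.
have h1 := norm1X M (norm1_diff k0).
have h2 : norm1 (e (i, j) * \sum_(l < N) Ci i ^+ (N.-1 - l) * Ci j ^+ l) <= C0 * N%:R.
  apply: le_trans (norm1M _ _) _; rewrite ler_pM ?norm1_ge0 //.
    by rewrite /C0 (bigD1 (i, j)) //= lerDl sumr_ge0 // => ij _; apply: norm1_ge0.
  apply: le_trans (norm1_sum _ _) _; rewrite -[N in N%:R]card_ord -sumr_const; apply: ler_sum => l _.
  apply: le_trans (norm1M _ _) _; rewrite -[leRHS]mulr1 ler_pM ?norm1_ge0 //.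
    by rewrite -[leRHS](expr1n _ (N.-1 - l)) norm1X // (CP i).2.
  by rewrite -[leRHS](expr1n _ l) norm1X // (CP j).2.
have NE : N%:R <= M.+1%:R * k%:R ^+ 2 :> rat.
  rewrite -natrX -natrM ler_nat /N; have : (0 < k ^ 2)%N by rewrite expn_gt0 k0.
  by lia.
apply: (@le_trans _ _ ((2 / k%:R) ^+ M * (C0 * (M.+1%:R * k%:R ^+ 2)))).
  rewrite ler_pM ?norm1_ge0 //; apply: le_trans h2 _; exact: ler_wpM2l.
rewrite exprMn exprVn le_eqVlt; apply/orP; left; apply/eqP; ring.
Qed.

Lemma ev_le r (s : meas r) f g : nonneg s -> (forall x, f x <= g x) -> ev s f <= ev s g.
Proof.
move=> /allP s0 fg; rewrite /ev !big_seq; apply: ler_sum => p ps.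
by rewrite ler_wpM2l // s0.
Qed.

Lemma ev_ge0 r (s : meas r) f : nonneg s -> (forall x, 0 <= f x) -> 0 <= ev s f.
Proof.
by move=> /allP s0 f0; rewrite /ev big_seq; apply: sumr_ge0 => p ps; rewrite mulr_ge0 // s0.
Qed.

Lemma pmass_ge0 r (s : meas r) x : nonneg s -> 0 <= pmass s x.
Proof. by move=> s0; apply: ev_ge0. Qed.

Lemma evZ r (s : meas r) c f : ev s (fun x => c * f x) = c * ev s f.
Proof. by rewrite /ev mulr_sumr; apply: eq_bigr => p _; ring. Qed.

Lemma pmass_conv_ge r (s t : meas r) x y : nonneg s -> nonneg t ->
  pmass s x * pmass t y <= pmass (conv s t) (x + y).
Proof.
move=> s0 t0; rewrite /pmass ev_conv mulrC -evZ; apply: ev_le => // a.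
rewrite mulrC -evZ; apply: ev_le => // b.
by case: eqP => [->|_]; case: eqP => [->|_]; rewrite ?eqxx ?mulr0 ?mul0r ?mul1r.
Qed.

Lemma pmass_bern_law_gt0 r (f : rat * 'rV[int]_r) : 0 < f.1 < 1 -> 0 < pmass (bern_law f) 0 /\ 0 < pmass (bern_law f) f.2.
Proof.
case/andP => f0 f1; rewrite /pmass /ev !big_cons !big_nil /= !eqxx !mulr1 !addr0.
split; [apply: ltr_wpDr|apply: ltr_wpDl]; rewrite ?subr_gt0 // mulr_ge0 // ?subr_ge0 ltW //.
Qed.

Lemma pmass_bern_sum_gt0 r (Fs : seq (rat * 'rV[int]_r)) :
  all (fun f => (0 < f.1) && (f.1 < 1)) Fs ->
  0 < pmass (bern_sum Fs) 0 /\ forall u x, (u, x) \in Fs -> 0 < pmass (bern_sum Fs) x.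
Proof.
elim: Fs => [|f Fs IH] /=.
  by rewrite /pmass /ev big_seq1 /= eqxx mulr1; split.
case/andP => f01 F01; have [IH0 IHx] := IH F01; have [f0 fx] := pmass_bern_law_gt0 f01.
have n1 : nonneg (bern_law f) by case/andP: f01 => a b; rewrite /nonneg /= subr_ge0 (ltW a) (ltW b).
have n2 := nonneg_bern_sum F01.
split; first by rewrite -[X in pmass _ X]addr0; apply: lt_le_trans (pmass_conv_ge _ _ n1 n2); rewrite mulr_gt0.
move=> u x; rewrite in_cons => /predU1P[fE|xF].
  rewrite -[x]addr0; apply: lt_le_trans (pmass_conv_ge _ _ n1 n2); rewrite mulr_gt0 //.
  by rewrite -[x]/((u, x).2) fE.
rewrite -[x]add0r; apply: lt_le_trans (pmass_conv_ge _ _ n1 n2); rewrite mulr_gt0 //.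
exact: IHx xF.
Qed.

Lemma tot_conv r (s t : meas r) : ev s (fun=> 1) = 1 -> ev t (fun=> 1) = 1 -> ev (conv s t) (fun=> 1) = 1.
Proof. by move=> s1 t1; rewrite ev_conv t1. Qed.

Lemma tot_bern_sum r (Fs : seq (rat * 'rV[int]_r)) : ev (bern_sum Fs) (fun=> 1) = 1.
Proof.
elim: Fs => [|f Fs IH] /=; first by rewrite /ev big_seq1 mulr1.
by apply: tot_conv => //; rewrite /ev big_cons big_seq1 /= !mulr1 subrK.
Qed.

Lemma tot_cpow r (s : meas r) n : ev s (fun=> 1) = 1 -> ev (cpow s n) (fun=> 1) = 1.
Proof.
by move=> s1; elim: n => [|n IH] /=; [rewrite /ev big_seq1 mulr1 | apply: tot_conv].
Qed.

Lemma ev_pm_le r (s : meas r) g (U : seq 'rV[int]_r) : nonneg s -> (forall x, 0 <= g x) -> uniq U ->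
  \sum_(y <- U) pmass s y * g y <= ev s g.
Proof.
move=> /allP s0 g0 uU; rewrite /pmass /ev.
under eq_bigr do rewrite mulr_suml.
rewrite exchange_big /= big_seq [leRHS]big_seq; apply: ler_sum => p ps.
under eq_bigr do rewrite -mulrA.
rewrite -mulr_sumr ler_wpM2l ?s0 //.
have [pU|pU] := boolP (p.2 \in U).
  rewrite (bigD1_seq p.2) //= eqxx mul1r big1 ?addr0 // => y /negPf.
  by rewrite eq_sym => ->; rewrite mul0r.
rewrite big_seq big1 // => y yU; case: eqP => [E|_]; last by rewrite mul0r.
by rewrite -E in yU; rewrite yU in pU.
Qed.

Lemma sum_pm r (s : meas r) : \sum_(y <- undup [seq p.2 | p <- s]) pmass s y = ev s (fun=> 1).
Proof.
rewrite /pmass /ev exchange_big /=; apply: eq_big_seq => p ps.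
rewrite -mulr_sumr; congr (_ * _).
rewrite (bigD1_seq p.2) ?undup_uniq //= ?eqxx ?mem_undup ?map_f // big1 ?addr0 // => y /negPf.
by rewrite eq_sym => ->.
Qed.

Lemma box_card r K (s : meas r) : bounded K s ->
  (size (undup [seq p.2 | p <- s]) <= (K.*2.+1) ^ r)%N.
Proof.
move=> /boundedP sK; set U := undup _.
pose h (x : 'rV[int]_r) : {ffun 'I_r -> 'I_(K.*2.+1)} := [ffun i => inord (absz (x 0 i + K%:Z))].
have hU : {in U &, injective h}.
  move=> x y; rewrite !mem_undup => /mapP[p ps ->] /mapP[q qs ->] /ffunP E.
  apply/rowP => i; have := E i; rewrite !ffunE => /(congr1 val) /=.
  have := sK _ ps i; have := sK _ qs i; move: (p.2 0 i) (q.2 0 i) => y1 y2 qK pK.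
  by rewrite !inordK; lia.
have : uniq (map h U) by rewrite map_inj_in_uniq // undup_uniq.
move/card_uniqP; rewrite size_map => <-; apply: leq_trans (max_card _) _.
by rewrite card_ffun !card_ord.
Qed.

Lemma sq_sum_ge (T : eqType) (U : seq T) (f : T -> rat) n : (size U <= n)%N -> (0 < n)%N ->
  \sum_(y <- U) f y = 1 -> n%:R^-1 <= \sum_(y <- U) f y ^+ 2.
Proof.
move=> Un n0 f1.
have n0' : 0 < n%:R :> rat by rewrite ltr0n.
have : 0 <= \sum_(y <- U) (f y - n%:R^-1) ^+ 2 by apply: sumr_ge0 => y _; apply: sqr_ge0.
have -> : \sum_(y <- U) (f y - n%:R^-1) ^+ 2 = \sum_(y <- U) f y ^+ 2 - 2 / n%:R + (size U)%:R * n%:R^-1 ^+ 2.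
  rewrite (eq_bigr (fun y => f y ^+ 2 + (- (2 / n%:R)) * f y + n%:R^-1 ^+ 2)); last by move=> y _; ring.
  by rewrite !big_split /= -mulr_sumr f1 big_const_seq count_predT iter_addr_0 !mulr1 [RHS]addrC [LHS]addrC [in RHS]mulr_natl.
have : (size U)%:R * n%:R^-1 ^+ 2 <= n%:R^-1 :> rat.
  rewrite expr2 mulrA; apply: ler_piMl; first by rewrite invr_ge0 ltW.
  by rewrite ler_pdivrMr // mul1r ler_nat.
lra.
Qed.

(** Two independent [N]-step walks live on at most [(2 N K + 1) ^ r] points, so by Cauchy-Schwarz
    they meet with at least the inverse of that probability. One more step, [x] for one walk and 0
    for the other, makes the difference equal to [x]. *)
Lemma walk_lower r (Fs : seq (rat * 'rV[int]_r)) K N u x :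
  all (fun f => (0 < f.1) && (f.1 < 1)) Fs -> bounded K (bern_sum Fs) -> (u, x) \in Fs ->
  pmass (bern_sum Fs) 0 * pmass (bern_sum Fs) x / (((N * K).*2.+1) ^ r)%N%:R <= pmass (walk Fs N.+1) x.
Proof.
move=> F01 FK xF; set B := bern_sum Fs; set D := cpow B N.
have B0 : nonneg B by apply: nonneg_bern_sum.
have D0 : nonneg D by apply: nonneg_cpow.
have E0 : nonneg (cpow B N.+1) by apply: nonneg_cpow.
have DK : bounded (N * K) D by apply: bounded_cpow.
set U := undup [seq p.2 | p <- D].
have -> : pmass (walk Fs N.+1) x = ev (cpow B N.+1) (fun b => pmass (cpow B N.+1) (x + b)).
  rewrite /walk -/B /pmass ev_conv /ev.
  under eq_bigr do rewrite big_map mulr_sumr.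
  rewrite exchange_big /=; apply: eq_bigr => q _; rewrite mulr_sumr.
  apply: eq_bigr => p _; rewrite mulrCA; congr (_ * (_ * _%:R)).
  by rewrite subr_eq.
have pE y z : pmass B z * pmass D y <= pmass (cpow B N.+1) (z + y) by apply: pmass_conv_ge.
have n0 : (0 < ((N * K).*2.+1) ^ r)%N by rewrite expn_gt0.
have U1 : \sum_(y <- U) pmass D y = 1.
  by rewrite sum_pm tot_cpow // tot_bern_sum.
apply: le_trans (ev_pm_le E0 _ (undup_uniq [seq p.2 | p <- D])); last by move=> b; apply: pmass_ge0.
have := sq_sum_ge (box_card DK) n0 U1.
move=> /(@ler_wpM2l _ (pmass B 0 * pmass B x)); rewrite mulr_ge0 ?pmass_ge0 // => /(_ isT) H.
apply: le_trans H _; rewrite mulr_sumr; apply: ler_sum => y _.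
have -> : pmass B 0 * pmass B x * pmass D y ^+ 2 = (pmass B 0 * pmass D y) * (pmass B x * pmass D y) by ring.
rewrite ler_pM ?mulr_ge0 ?pmass_ge0 //; by have := pE y 0; rewrite add0r.
Qed.

(** * Moving discrepancies towards the origin *)

Lemma bezout_ord n (f : 'I_n -> int) : exists z : 'I_n -> int,
  forall i, (\sum_j f j * z j %| f i)%Z.
Proof.
elim: n f => [|n IH] f; first by exists (fun=> 0) => -[].
have [z zP] := IH (fun j => f (lift ord0 j)).
set g := \sum_j _ in zP.
have [u [v uv]] := Bezoutz (f ord0) g.
exists (fun i => if unlift ord0 i is Some j then v * z j else u) => i.
have -> : \sum_j f j * (if unlift ord0 j is Some j' then v * z j' else u) = gcdz (f ord0) g.
  rewrite big_ord_recl unlift_none -uv mulrC; congr (_ + _).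
  by rewrite mulr_sumr; apply: eq_bigr => j _; rewrite liftK; ring.
case: (unliftP ord0 i) => [j|] ->; last exact: dvdz_gcdl.
exact: dvdz_trans (dvdz_gcdr _ _) (zP j).
Qed.

(** The greatest common divisor of the other coefficients divides [a i], so [a i] is an integer
    combination of them. *)
Lemma unit_row r (a : 'I_r -> int) i :
  (forall d : int, (forall j, j != i -> (d %| a j)%Z) -> (d %| a i)%Z) ->
  exists2 w : 'rV[int]_r, orth a w & w 0 i = 1.
Proof.
move=> hd; have [z zP] := bezout_ord (fun j => if j == i then 0 else a j).
set g := \sum_j _ in zP.
have /dvdzP[c cE] : (g %| a i)%Z.
  by apply: hd => j /negPf ji; have := zP j; rewrite ji.
exists (\row_j (if j == i then 1 else - c * z j)); last by rewrite mxE eqxx.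
rewrite /orth (bigD1 i) //= mxE eqxx mulr1 cE /g (bigD1 i) //= eqxx mul0r add0r mulr_sumr -big_split /=.
by apply/eqP/big1 => j /negPf ji; rewrite mxE ji; ring.
Qed.

(** Write [n = k * q' + m] with [q'] the dominant entry of the vector [v i] of [spike], and take [k]
    times [v i] plus [m] times the row [w i] of [unit_row]. The other entries of [v i] are at most
    [|q'| - 1], so the multiple of [v i] shrinks by [1 - 1 / |q'|] off [i], and the second term is
    bounded. *)
Lemma shrink_row r (a : 'I_r -> int) :
  (forall i (d : int), (forall j, j != i -> (d %| a j)%Z) -> (d %| a i)%Z) ->
  (forall i, `|a i| < \sum_(j < r | j != i) `|a j|) ->
  exists D n0 : nat, (1 < D)%N /\ forall i (n : int), n0%:Z < `|n| ->
   exists x : 'rV[int]_r, [/\ orth a x, x 0 i = n &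
     forall j, j != i -> D%:Z * `|x 0 j| <= (D%:Z - 1) * `|n|].
Proof.
move=> hd ha.
have /fin_all_exists2[w wo wi] := fun i => unit_row (hd i).
have /fin_all_exists[v] := fun i => spike (ha i).
move=> /fin_all_exists[t] /fin_all_exists[s vP].
pose Q : int := 1 + \sum_i `|v i 0 i|.
pose W : int := \sum_i \sum_j `|w i 0 j|.
have Q1 : 1 <= Q by rewrite /Q lerDl sumr_ge0.
have W0 : 0 <= W by apply: sumr_ge0 => i _; apply: sumr_ge0.
(* [Q] exceeds every [|v i 0 i|], so the ratio [1 - 1 / (2 Q)] is weaker than [1 - 1 / |q'|]. Beyond
   the second constant this slack absorbs the bounded terms, uniformly in [i]. *)
exists (absz (2 * Q)), (absz (2 * (Q ^+ 2 * (1 + W)))); split; first by lia.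
move=> i n nn; have [vo t0 s0 v2] := vP i.
have sqlt (x y : int) : x ^+ 2 < y ^+ 2 -> `|x| < `|y|.
  by rewrite -[x ^+ 2]real_normK ?num_real // -[y ^+ 2]real_normK ?num_real // ltr_pXn2r ?nnegrE.
set q' := v i 0 i; have q'2 : q' ^+ 2 = t i + s i by rewrite /q' v2 eqxx mulr1.
set q := `|q'|.
have vj j : j != i -> `|v i 0 j| < q.
  by move=> /negPf ji; apply: sqlt; rewrite q'2 v2 ji mulr0 addr0 ltrDl.
have q0 : 0 < q by rewrite -(normr0 int); apply: sqlt; rewrite q'2 expr0n /=; lia.
have qQ : q + 1 <= Q.
  rewrite /Q (bigD1 i) //= -/q' -/q.
  by rewrite [leRHS]addrCA lerD2l lerDl; apply: sumr_ge0.
have wW j : `|w i 0 j| <= W.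
  rewrite /W (bigD1 i) //= (bigD1 j) //= -addrA lerDl addr_ge0 ?sumr_ge0 // => k _.
  exact: sumr_ge0.
have q'0 : q' != 0 by rewrite -normr_gt0.
pose k := (n %/ q')%Z; pose m := (n %% q')%Z.
have nE : n = k * q' + m := divz_eq n q'.
have m0 : 0 <= m := modz_ge0 n q'0.
have mq : m < q := ltz_mod n q'0.
exists (k *: v i + m *: w i); split.
- by apply: orthD; apply: orthZ.
- by rewrite !mxE wi mulr1.
move=> j /vj vjq; rewrite !mxE.
have kq : `|k| * q <= `|n| + q.
  rewrite -normrM; have -> : k * q' = n - m by rewrite {1}nE addrK.
  by apply: le_trans (ler_normB _ _) _; rewrite lerD2l ger0_norm // ltW.
have xle : `|k * v i 0 j + m * w i 0 j| <= `|k| * (q - 1) + q * W.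
  apply: le_trans (ler_normD _ _) _; rewrite !normrM (ger0_norm m0); apply: lerD.
    by rewrite ler_wpM2l //; lia.
  by rewrite ler_pM // ltW.
clearbody Q W; have A1 : 0 <= 2 * Q by lia.
have A2 : 0 <= 2 * (Q ^+ 2 * (1 + W)).
  by rewrite mulr_ge0 // mulr_ge0 ?sqr_ge0 // addr_ge0.
move: nn; rewrite !gez0_abs // => nn.
set X := `|_ + _| in xle *; move: (`|k|) (`|n|) kq xle nn => K N kq xle nn.
have qX : q * X <= (N + q) * (q - 1) + q ^+ 2 * W.
  apply: le_trans (_ : q * (K * (q - 1) + q * W) <= _); first by rewrite ler_wpM2l // ltW.
  have -> : q * (K * (q - 1) + q * W) = (K * q) * (q - 1) + q ^+ 2 * W by ring.
  by rewrite lerD2r ler_wpM2r //; lia.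
rewrite -(ler_pM2l q0).
have qq : q ^+ 2 * (1 + W) <= Q ^+ 2 * (1 + W).
  by rewrite ler_wpM2r ?addr_ge0 // ler_pXn2r ?nnegrE ?ltW //; lia.
apply: le_trans (_ : 2 * Q * ((N + q) * (q - 1) + q ^+ 2 * W) <= _).
  by rewrite mulrCA ler_wpM2l //; lia.
have h1 : 2 * (q ^+ 2 * (1 + W)) <= N by lia.
have N0 : 0 <= N by apply: le_trans h1; rewrite !mulr_ge0 ?addr_ge0 ?sqr_ge0.
have h3 : (q + 1) * N <= Q * N by rewrite ler_wpM2r.
have h4 : 0 <= Q * q by rewrite mulr_ge0 ?ltW //; lia.
rewrite -subr_ge0; set L := _ - _.
have -> : L = (Q * N - Q * (2 * (q ^+ 2 * (1 + W)))) + (Q * N - (q + 1) * N) + N + 2 * (Q * q).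
  by rewrite /L; ring.
have h5 : Q * (2 * (q ^+ 2 * (1 + W))) <= Q * N by rewrite ler_wpM2l //; lia.
apply: addr_ge0; last by rewrite mulr_ge0.
by apply: addr_ge0 => //; apply: addr_ge0; rewrite subr_ge0.
Qed.

Lemma ev_cat r (s t : meas r) f : ev (s ++ t) f = ev s f + ev t f.
Proof. by rewrite /ev big_cat. Qed.

Lemma ev_wscale r c (s : meas r) f : ev (wscale c s : meas r) f = c * ev s f.
Proof. by rewrite /ev big_map mulr_sumr; apply: eq_bigr => p _; rewrite mulrA. Qed.

(* Column functions only matter up to a part [g] common to all columns: in particular
   minus the unit mass in column [i] is the sum of the unit masses in the others. *)
Definition fixes r (a : 'I_r -> int) (n0 : nat) (d : 'I_r -> int -> rat) (b : rat) :=
  exists (s : meas r) (h : 'I_r -> int -> rat) (g : int -> rat),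
  [/\ nonneg s, supported a s, forall j m, cmass s j m = d j m + h j m + g m,
      forall j (m : int), n0%:Z < `|m| -> h j m = 0 & forall j m, `|h j m| <= b].

Lemma fixes_ext r (a : 'I_r -> int) n0 d d' b (g0 : int -> rat) :
  (forall j m, d' j m = d j m + g0 m) -> fixes a n0 d b -> fixes a n0 d' b.
Proof.
move=> dd [s [h [g [s0 sa sE h0 hb]]]]; exists s, h, (fun m => g m - g0 m); split => // j m.
by rewrite sE dd; ring.
Qed.

Lemma fixesW r (a : 'I_r -> int) n0 d b b' : b <= b' -> fixes a n0 d b -> fixes a n0 d b'.
Proof.
move=> bb [s [h [g [s0 sa sE h0 hb]]]]; exists s, h, g; split => // j m.
exact: le_trans (hb j m) bb.
Qed.

Lemma fixesD r (a : 'I_r -> int) n0 d b d' b' : fixes a n0 d b -> fixes a n0 d' b' ->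
  fixes a n0 (fun j m => d j m + d' j m) (b + b').
Proof.
move=> [s [h [g [s0 sa sE h0 hb]]]] [s' [h' [g' [s0' sa' sE' h0' hb']]]].
exists (s ++ s'), (fun j m => h j m + h' j m), (fun m => g m + g' m); split.
- by rewrite /nonneg all_cat; apply/andP.
- by rewrite /supported all_cat; apply/andP.
- by move=> j m; rewrite /cmass ev_cat -!/(cmass _ _ _) sE sE'; ring.
- by move=> j m mm; rewrite h0 // h0' // addr0.
by move=> j m; apply: le_trans (ler_normD _ _) _; apply: lerD.
Qed.

Lemma fixes_core r (a : 'I_r -> int) n0 d b :
  (forall j (m : int), n0%:Z < `|m| -> d j m = 0) -> (forall j m, `|d j m| <= b) -> fixes a n0 d b.
Proof.
move=> d0 db; exists [::], (fun j m => - d j m), (fun=> 0); split => //.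
- by move=> j m; rewrite /cmass /ev big_nil; ring.
- by move=> j m /d0 ->; rewrite oppr0.
by move=> j m; rewrite normrN.
Qed.

Lemma fixes_row r (a : 'I_r -> int) n0 (x : 'rV[int]_r) c : orth a x -> 0 <= c ->
  fixes a n0 (fun j m => c * (x 0 j == m)%:R) 0.
Proof.
move=> ox c0; exists [:: (c, x)], (fun _ _ => 0), (fun=> 0); split => //.
- by rewrite /nonneg /= c0.
- by rewrite /supported /= ox.
- by move=> j m; rewrite /cmass /ev big_seq1 /=; ring.
Qed.

Lemma fixes_sum r (a : 'I_r -> int) n0 (I : Type) (l : seq I) (P : pred I) d b :
  (forall k, P k -> fixes a n0 (d k) (b k)) ->
  fixes a n0 (fun j m => \sum_(k <- l | P k) d k j m) (\sum_(k <- l | P k) b k).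
Proof.
move=> H; elim: l => [|k l IH].
  apply: (@fixes_ext _ _ _ (fun _ _ => 0) _ _ (fun=> 0)).
    by move=> j m; rewrite big_nil addr0.
  by apply: fixes_core => // j m; rewrite normr0 big_nil.
rewrite big_cons; case: ifP => Pk.
  apply: (@fixes_ext _ _ _ _ _ _ (fun=> 0)) (fixesD (H k Pk) IH) => j m.
  by rewrite big_cons Pk addr0.
by apply: (@fixes_ext _ _ _ _ _ _ (fun=> 0)) IH => j m; rewrite big_cons Pk addr0.
Qed.

Definition single r (i : 'I_r) (n : int) (c : rat) (j : 'I_r) (m : int) : rat :=
  c * ((j == i) && (m == n))%:R.

Lemma fixes_opp r (a : 'I_r -> int) n0 i n c b :
  (forall j, fixes a n0 (single j n c) b) -> 0 <= b -> fixes a n0 (single i n (- c)) (r%:R * b).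
Proof.
move=> H b0; have := @fixes_sum r a n0 _ (enum 'I_r) (fun j => j != i) (fun j => single j n c) (fun=> b) (fun j _ => H j).
rewrite !big_enum_cond /= => F; apply: fixesW (_ : \sum_(j | j != i) b <= _) _.
  rewrite big_mkcond -[r in r%:R]card_ord mulr_natl -sumr_const; apply: ler_sum => j _.
  by case: ifP.
apply: (@fixes_ext _ _ _ _ _ _ (fun m => - c * (m == n)%:R)) F => j m.
rewrite big_enum_cond /= /single; have [->|ji] := eqVneq j i.
  rewrite big1 ?add0r // => k /negPf ki; rewrite eq_sym ki mulr0.
  by [].
rewrite (bigD1 j) //= eqxx /= big1 ?addr0; first by rewrite mulr0; ring.
by move=> k /andP[_ /negPf kj]; rewrite eq_sym kj mulr0.
Qed.

(** A mass [c] at [n] in column [i] is the column function of [c] times a lattice point [x], less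
    masses [c] at the smaller places [x 0 j] of the other columns. By [fixes_opp] these negative
    masses become positive ones. A round costs at most a factor [r ^ 2], and the places shrink
    geometrically, so the total cost is polynomial in [|n|]. *)
Lemma peel r (a : 'I_r -> int) D n1 : (1 < D)%N ->
  (forall i (n : int), n1%:Z < `|n| ->
   exists x : 'rV[int]_r, [/\ orth a x, x 0 i = n &
     forall j, j != i -> D%:Z * `|x 0 j| <= (D%:Z - 1) * `|n|]) ->
  exists n0 kp : nat, forall i (n : int) (c : rat),
    fixes a n0 (single i n c) (`|c| * r%:R * (1 + `|n|%:~R) ^+ kp).
Proof.
(* With this [y], the shrinking gives [(1 + y) * (1 + |x 0 j|) <= 1 + |n|] as soon as [|n| >= 1]. By
   Bernoulli's inequality a large power [kp] of [1 + y] pays for the factor [r ^ 2]. *)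
move=> D1 rows; pose y : rat := (D.*2.-1)%:R^-1.
have E0 : 0 < (D.*2.-1)%:R :> rat by rewrite ltr0n; lia.
have y0 : 0 < y by rewrite invr_gt0.
have [kp kpP] : exists kp : nat, r%:R ^+ 2 <= (1 + y) ^+ kp.
  exists (r ^ 2 * D.*2.-1)%N; have bern k : 1 + k%:R * y <= (1 + y) ^+ k.
    elim: k => [|k IH]; first by rewrite mul0r addr0.
    rewrite exprS; apply: le_trans (_ : (1 + y) * (1 + k%:R * y) <= _); last first.
      by rewrite ler_wpM2l // addr_ge0 // ltW.
    have : 0 <= k%:R * y ^+ 2 by rewrite mulr_ge0 ?exprn_ge0 // ltW.
    by rewrite -natr1; nra.
  apply: le_trans (bern _); rewrite natrM -mulrA /y mulfV ?gt_eqF // mulr1 natrX.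
  by rewrite lerDr.
exists (maxn n1 1), kp.
pose be (n : int) : rat := (1 + `|n|%:~R) ^+ kp.
have be0 n : 0 <= be n by rewrite exprn_ge0 // addr_ge0.
have small n i c : 0 <= c -> `|n| <= (maxn n1 1)%:Z -> fixes a (maxn n1 1) (single i n c) (c * be n).
  move=> c0 nn; apply: fixes_core => j m.
    rewrite /single => mm; case: (m =P n) => [mn|_]; last by rewrite andbF mulr0.
    by rewrite mn ltNge nn in mm.
  rewrite /single normrM (ger0_norm c0) ler_wpM2l //.
  apply: (@le_trans _ _ 1); first by case: (_ && _); rewrite ?normr1 ?normr0.
  by rewrite exprn_ege1 // lerDl.
have pos N : forall (n : int), `|n| <= N%:Z -> forall i c, 0 <= c ->
    fixes a (maxn n1 1) (single i n c) (c * be n).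
  elim: N => [|N IH] n nN i c c0; have [nn|nn] := leP `|n| (maxn n1 1)%:Z.
  - exact: small.
  - by lia.
  - exact: small.
  have [|x [ox xi xj]] := rows i n; first by lia.
  have xN j : j != i -> `|x 0 j| <= N%:Z.
    by move=> /xj; move: (x 0 j) => z zj; nia.
  have r0 : (0 < r)%N by apply: leq_ltn_trans (ltn_ord i).
  have bx j : j != i -> r%:R ^+ 2 * be (x 0 j) <= be n.
    move=> /xj zj; have z1 : (1 + y) * (1 + `|x 0 j|%:~R) <= 1 + `|n|%:~R.
      have D0 : 0 < D.*2.-1%:Z by lia.
      have dy : (D.*2.-1)%:R * (1 + y) = (D.*2.-1)%:R + 1 by rewrite mulrDr mulr1 /y mulfV ?gt_eqF.
      rewrite -(ler_pM2l E0) mulrA dy.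
      have : (D.*2.-1%:Z + 1) * (1 + `|x 0 j|) <= D.*2.-1%:Z * (1 + `|n|).
        by have -> : D.*2.-1%:Z = 2 * D%:Z - 1 by [lia]; move: zj; lia.
      by rewrite -(@ler_int rat) !rmorphM !rmorphD /=.
    apply: le_trans (_ : (1 + y) ^+ kp * be (x 0 j) <= _); first by rewrite ler_wpM2r.
    rewrite -exprMn; apply: lerXn2r; rewrite ?nnegrE ?mulr_ge0 ?addr_ge0 //; exact: ltW.
  have F1 := fixes_row (maxn n1 1) ox c0.
  have F2 : fixes a (maxn n1 1) (fun j m => \sum_(k | k != i) single k (x 0 k) (- c) j m)
      (\sum_(k | k != i) r%:R * (c * be (x 0 k))).
    have := @fixes_sum r a (maxn n1 1) _ (enum 'I_r) (fun k => k != i)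
       (fun k => single k (x 0 k) (- c)) (fun k => r%:R * (c * be (x 0 k))).
    move=> F; have {}F := F (fun k ki => @fixes_opp _ _ _ _ _ _ _ (fun j => IH _ (xN k ki) j c c0) (mulr_ge0 c0 (be0 _))).
    apply: fixesW (_ : \sum_(k <- enum 'I_r | k != i) r%:R * (c * be (x 0 k)) <= _) _.
      by rewrite big_enum_cond.
    by apply: (@fixes_ext _ _ _ _ _ _ (fun=> 0)) F => j m; rewrite big_enum_cond addr0.
  have {F1 F2} F := fixesD F1 F2; apply: fixesW (_ : 0 + \sum_(k | k != i) r%:R * (c * be (x 0 k)) <= _) _.
    (* Each column other than [i] may use the share [1 / r] of the bound. *)
    rewrite add0r; apply: le_trans (_ : \sum_(k : 'I_r) r%:R^-1 * (c * be n) <= _).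
      rewrite big_mkcond; apply: ler_sum => k _; case: ifP => [ki|_].
        rewrite mulrCA [leRHS]mulrCA ler_wpM2l // -(@ler_pM2l _ r%:R) ?ltr0n //.
        by rewrite mulVKf ?pnatr_eq0 -?lt0n // mulrA -expr2 bx.
      by rewrite !mulr_ge0 // invr_ge0.
    by rewrite sumr_const card_ord -[leLHS]mulr_natl mulVKf // pnatr_eq0 -lt0n.
  apply: (@fixes_ext _ _ _ _ _ _ (fun=> 0)) F => j m; rewrite addr0 /single.
  have [->|ji] := eqVneq j i.
    rewrite xi eq_sym big1 ?addr0 // => k /negPf ki; by rewrite eq_sym ki mulr0.
  rewrite (bigD1 j) //= eqxx big1 ?addr0.
    by rewrite mulr0 [m == _]eq_sym /=; ring.
  by move=> k /andP[_ /negPf kj]; rewrite eq_sym kj mulr0.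
move=> i n c; have r0 : (0 < r)%N by apply: leq_ltn_trans (ltn_ord i).
have [c0|c0] := leP 0 c.
  apply: fixesW (pos (absz n) n _ i c c0); last by lia.
  rewrite ger0_norm // -/(be n) -mulrA ler_wpM2l // ler_peMl // ler1n.
  by [].
rewrite -[c]opprK; apply: fixesW (_ : r%:R * (- c * be n) <= _) _.
  by rewrite opprK ltr0_norm // -/(be n) mulrA [_ * - c]mulrC.
apply: fixes_opp; last by rewrite mulr_ge0 // oppr_ge0 ltW.
by move=> j; apply: (pos (absz n)); [lia|rewrite oppr_ge0 ltW].
Qed.

(** Adjoining vectors of [P] that raise the rank must stop, as the rank is at most [d]. *)
Lemma span_pred (F : fieldType) d (P : 'rV[F]_d -> Prop) :
  exists q (A : 'M[F]_(q, d)), (forall k, P (row k A)) /\ forall v, P v -> (v <= A)%MS.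
Proof.
have H k : (exists q (A : 'M[F]_(q, d)), (forall k, P (row k A)) /\ forall v, P v -> (v <= A)%MS) \/
   exists q (A : 'M[F]_(q, d)), (forall k, P (row k A)) /\ (k <= \rank A)%N.
  elim: k => [|k [IH|[q [A [AP Ak]]]]]; [|by left|].
    by right; exists 0%N, 0; split => // -[].
  have [AE|] := pselect (forall v, P v -> (v <= A)%MS); first by left; exists q, A.
  move=> /existsNP[v /not_implyP[Pv /negP vA]]; right.
  exists (q + 1)%N, (col_mx A v); split.
    move=> j; rewrite -[j]fintype.splitK; case: (fintype.split j) => l /=; first by rewrite rowKu.
    by rewrite rowKd row_id; case: l => -[].
  apply: leq_ltn_trans Ak _; apply: rank_ltmx; rewrite ltmxE; apply/andP; split.
    by rewrite -addsmxE addsmxSl.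
  by apply: contra vA => /(submx_trans _); apply; rewrite -addsmxE addsmxSr.
have [//|[q [A [_ Ad]]]] := H d.+1.
by have := rank_leq_col A; rewrite leqNgt Ad.
Qed.

(** * Existence of a balanced measure *)

Definition realizable r (a : 'I_r -> int) (h : 'I_r -> int -> rat) (s : meas r) :=
  supported a s /\ exists g : int -> rat, forall j m, cmass s j m = h j m + g m.

(** The realizable [h] supported in the box lie in the span of finitely many of them, each realised
    by a fixed signed measure [s k]; [T] collects the supports. A pseudo-inverse gives coefficients
    of [h] that are linear in [h], hence bounded by a constant times [b]. *)
Lemma core_fix r (a : 'I_r -> int) n0 : exists (T : seq 'rV[int]_r) (C : rat),
  [/\ all (orth a) T, 0 <= C & forall h b,
    (forall j (m : int), n0%:Z < `|m| -> h j m = 0) -> (exists s, realizable a h s) ->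
    (forall j m, `|h j m| <= b) ->
    exists v, [/\ realizable a h v, forall x, x \notin T -> pmass v x = 0 & forall x, `|pmass v x| <= C * b]].
Proof.
pose J : finType := ('I_r * 'I_(n0.*2.+1))%type.
(* The index [t.2] stands for the integer [t.2 - n0]. *)
pose enc (h : 'I_r -> int -> rat) : 'rV[rat]_#|J| :=
  \row_k let t : 'I_r * 'I_(n0.*2.+1) := enum_val (k : 'I_#|J|) in h t.1 (t.2%:Z - n0%:Z).
pose dec (v : 'rV[rat]_#|J|) (j : 'I_r) (m : int) : rat :=
  if `|m| <= n0%:Z then v 0 (enum_rank (j, inord (absz (m + n0%:Z)) : 'I_(n0.*2.+1))) else 0.
have encK h : (forall j (m : int), n0%:Z < `|m| -> h j m = 0) -> forall j m, dec (enc h) j m = h j m.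
  move=> h0 j m; rewrite /dec; case: leP => [mn|/h0 //].
  rewrite mxE enum_rankK /= inordK; last by lia.
  by congr h; lia.
have [q [A [AP Aspan]]] := span_pred (fun v => exists s, realizable a (dec v) s).
have /fin_all_exists[s sP] := AP.
pose tv k : rat := \sum_(p <- s k) `|p.1|.
have tv0 k : 0 <= tv k by apply: sumr_ge0.
pose B : 'M[rat]_(#|J|, q) := pinvmx A.
pose bk k : rat := \sum_l `|B l k|.
exists (flatten [seq [seq p.2 | p <- s k] | k : 'I_q]), (\sum_k bk k * tv k).
split.
- apply/allP => x /flattenP[_ /mapP[k _ ->] /mapP[p ps ->]].
  by have [so _] := sP k; apply: (allP so).
- by apply: sumr_ge0 => k _; rewrite mulr_ge0 // sumr_ge0.
move=> h b h0 [s0 [s0a [g0 s0E]]] hb.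
have hA : (enc h <= A)%MS.
  by apply: Aspan; exists s0; split => //; exists g0 => j m; rewrite encK.
pose c := enc h *m B.
have cE : enc h = c *m A by rewrite /c /B mulmxKpV.
have cb k : `|c 0 k| <= b * bk k.
  rewrite mxE; apply: le_trans (ler_norm_sum _ _ _) _; rewrite /bk mulr_sumr.
  by apply: ler_sum => l _; rewrite normrM ler_wpM2r // mxE.
pose v := flatten [seq wscale (c 0 k) (s k) | k : 'I_q].
have evv f : ev v f = \sum_k c 0 k * ev (s k) f.
  by rewrite /ev big_flatten big_map big_enum /=; apply: eq_bigr => k _; exact: ev_wscale.
exists v; split.
- split.
    apply/allP => p /flattenP[_ /mapP[k _ ->] /mapP[p' ps ->]] /=.
    by have [so _] := sP k; apply: (allP so).
  have /fin_all_exists[g gP] : forall k, exists g : int -> rat, forall j m, cmass (s k) j m = dec (row k A) j m + g m.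
    by move=> k; have [_ []] := sP k; move=> g; exists g.
  exists (fun m => \sum_k c 0 k * g k m) => j m.
  rewrite /cmass evv; under eq_bigr do rewrite -/(cmass _ _ _) gP mulrDr.
  rewrite big_split /=; congr (_ + _).
  rewrite -(encK _ h0) cE /dec; case: ifP => _; last by rewrite big1 // => k _; rewrite mulr0.
  by rewrite [RHS]mxE; apply: eq_bigr => k _; rewrite [row k A _ _]mxE.
- move=> x xT; rewrite /pmass evv big1 // => k _.
  rewrite /ev big_seq big1 ?mulr0 // => p ps; case: eqP => [px|]; last by rewrite mulr0.
  case/negP: xT; apply/flattenP; exists [seq p.2 | p <- s k]; first by apply: map_f; rewrite mem_enum.
  by apply/mapP; exists p.
move=> x; rewrite /pmass evv; apply: le_trans (ler_norm_sum _ _ _) _.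
rewrite mulr_suml; apply: ler_sum => k _; rewrite normrM mulrAC.
apply: ler_pM => //; first by rewrite mulrC.
apply: le_trans (ler_norm_sum _ _ _) _; apply: ler_sum => p _; rewrite normrM.
by case: eqP; rewrite ?normr1 ?normr0 ?mulr1 ?mulr0.
Qed.

(** Merging the entries at a point makes the weight equal to the mass, so a signed list with
    nonnegative masses becomes a list with nonnegative weights. *)
Lemma collect r (s : meas r) : exists t : meas r,
  [/\ forall f, ev t f = ev s f, [seq p.2 | p <- t] = undup [seq p.2 | p <- s]
    & forall p, p \in t -> p.1 = pmass s p.2].
Proof.
exists [seq (pmass s x, x) | x <- undup [seq p.2 | p <- s]]; split; last 2 first.
- by rewrite -map_comp map_id.
- by move=> _ /mapP[x _ ->].
move=> f; rewrite {1}/ev big_map /= /pmass /ev.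
under eq_bigr do rewrite mulr_suml.
rewrite exchange_big /=; apply: eq_big_seq => p ps.
under eq_bigr do rewrite -mulrA.
rewrite -mulr_sumr; congr (_ * _).
rewrite (bigD1_seq p.2) ?undup_uniq //= ?eqxx ?mem_undup ?map_f // mul1r big1 ?addr0 // => y /negPf.
by rewrite eq_sym => ->; rewrite mul0r.
Qed.

Lemma pos_min (T : eqType) (l : seq T) (f : T -> rat) : (forall x, x \in l -> 0 < f x) ->
  exists2 c, 0 < c & forall x, x \in l -> c <= f x.
Proof.
elim: l => [|x l IH] H; first by exists 1.
have [|c c0 cl] := IH; first by move=> y yl; rewrite H // in_cons yl orbT.
exists (Num.min c (f x)); first by rewrite lt_min c0 H // mem_head.
move=> y; rewrite in_cons => /predU1P[->|/cl]; rewrite ge_min ?lexx ?orbT //.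
by move=> ->.
Qed.

Lemma fixes_all r (a : 'I_r -> int) n0 kp (d : 'I_r -> int -> rat) R e :
  (forall i n c, fixes a n0 (single i n c) (`|c| * r%:R * (1 + `|n|%:~R) ^+ kp)) ->
  (forall j (m : int), R%:Z < `|m| -> d j m = 0) -> (forall j m, `|d j m| <= e) -> 0 <= e ->
  fixes a n0 d ((r * R.*2.+1)%:R * (e * r%:R * (1 + R%:R) ^+ kp)).
Proof.
move=> H d0 de e0.
pose J : finType := ('I_r * 'I_(R.*2.+1))%type.
pose n (t : J) : int := t.2%:Z - R%:Z.
have F := @fixes_sum r a n0 _ (enum J) xpredT (fun t => single t.1 (n t) (d t.1 (n t)))
   (fun=> e * r%:R * (1 + R%:R) ^+ kp).
have side t : `|d t.1 (n t)| * r%:R * (1 + `|n t|%:~R) ^+ kp <= e * r%:R * (1 + R%:R) ^+ kp.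
  have nR : `|n t| <= R%:Z by rewrite /n; move: (ltn_ord t.2); move: (nat_of_ord t.2) => z; lia.
  rewrite ler_pM ?mulr_ge0 ?exprn_ge0 ?addr_ge0 ?ler_wpM2r //.
  by apply: lerXn2r; rewrite ?nnegrE ?addr_ge0 // lerD2l -[R%:R]/(R%:Z%:~R) ler_int.
have {}F := F (fun t _ => fixesW (side t) (H t.1 (n t) (d t.1 (n t)))).
apply: fixesW (_ : \sum_(t <- enum J | true) e * r%:R * (1 + R%:R) ^+ kp <= _) _.
  by rewrite big_enum sumr_const /= card_prod !card_ord mulr_natl.
apply: (@fixes_ext _ _ _ _ _ _ (fun=> 0)) F => j m.
rewrite addr0 big_enum /= /single.
have [mR|mR] := leP `|m| R%:Z; last first.
  rewrite d0 // big1 // => t _; case: andP => [[_ /eqP mn]|_]; last by rewrite mulr0.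
  by move: mR; rewrite mn /n; move: (ltn_ord t.2); move: (nat_of_ord t.2) => z; lia.
have tm : (absz (m + R%:Z)%R < R.*2.+1)%N by lia.
rewrite (bigD1 ((j, Ordinal tm) : J)) //= /n /= big1 => [|t tn].
  have -> : (absz (m + R%:Z))%:Z - R%:Z = m by lia.
  by rewrite !eqxx mulr1 addr0.
case: andP => [[/eqP jt /eqP mt]|_]; last by rewrite mulr0.
case/eqP: tn; case: t jt mt => t1 t2 /= -> mt; congr (_, _); apply: val_inj => /=; lia.
Qed.

Theorem balanced_exists r (a : 'I_r -> int) : (0 < r)%N ->
  (forall i (d : int), (forall j, j != i -> (d %| a j)%Z) -> (d %| a i)%Z) ->
  (forall i, `|a i| < \sum_(j < r | j != i) `|a j|) ->
  exists s : meas r, [/\ nonneg s, supported a s, forall i j n, cmass s i n = cmass s j n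
    & exists2 x, x != 0 & 0 < pmass s x].
Proof.
move=> r0 hd ha; pose j0 := Ordinal r0.
have [D [n1 [D1 rows]]] := shrink_row hd ha.
have [n0 [kp fixP]] := peel D1 rows.
have [T [C [oT C0 coreP]]] := core_fix a n0.
have /fin_all_exists2[w wo wi] := fun i => unit_row (hd i).
(* The walk has to dominate the correction on [T]. The rows [w i] give a factor [half_step] in every
   column and a nonzero point of positive mass. *)
pose X0 := T ++ [seq w i | i : 'I_r].
have oX0 : all (orth a) X0.
  by rewrite all_cat oT; apply/allP => _ /mapP[i _ ->].
have wX i : w i \in X0 by rewrite mem_cat map_f ?orbT ?mem_enum.
(* The discrepancy is of order [k ^ 2 / k ^ M]. Moving it costs [k ^ 2] for the number of places and
   [k ^ (2 kp)] for their weights, and comparison with the walk costs [k ^ (2 r)]. One power of [k]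
   is left over. *)
have [M ME] : exists M, M = (5 + kp.*2 + r.*2)%N by eexists.
have [Fs [FP FX FM]] := matched_moments M ha oX0.
have F01 : all (fun f => (0 < f.1) && (f.1 < 1)) Fs by apply: sub_all FP => f /and3P[-> ->].
have Fa : supported a Fs by apply: sub_all FP => f /and3P[].
have [|C1 C10 C1P] := walk_cmass F01 (M := M) _ (fun i j k kM => FM i j k (ltnW kM)).
  by move=> i; exists (w i) => //; apply: FX.
pose K := (\sum_(p <- bern_sum Fs) \sum_(i < r) absz (p.2 0 i)%R)%N.
have BK : bounded K (bern_sum Fs).
  apply/boundedP => p pF i; by rewrite -abszE lez_nat /K (big_rem p) //= (bigD1 i) //= -addnA leq_addr.
clearbody K; have [B0 Bx] := pmass_bern_sum_gt0 F01.
have [c c0 cP] : exists2 c, 0 < c & forall x, x \in X0 -> c <= pmass (bern_sum Fs) 0 * pmass (bern_sum Fs) x.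
  by apply: pos_min => x xX; rewrite mulr_gt0 // (Bx 2^-1) // FX.
(* [A * k ^ 2] bounds the widths [2 R + 1] and [2 N1 K + 1] of the boxes that contain the walks. *)
pose A := (4 * K * M.+1 + 1)%N.
(* [Q] gathers the factors free of [k] in the bound of [C * b * (A * k ^ 2) ^ r], which becomes
   [Q / k]; this is below [c] by the choice of [k]. *)
pose Q : rat := C * (r%:R ^+ 2 * A%:R ^+ (kp.+1 + r) * C1).
have Q0 : 0 <= Q by rewrite !mulr_ge0 ?exprn_ge0.
pose k := (Num.bound (Q / c)).+1.
have k0 : 0 < k%:R :> rat by rewrite ltr0n.
have Qk : Q < c * k%:R.
  rewrite mulrC -ltr_pdivrMr //; apply: lt_le_trans (archi_boundP _) _; first by rewrite divr_ge0 // ltW.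
  by rewrite ler_nat.
clearbody k; have [N1 N1E] : exists N1, N1 = (M * k ^ 2)%N by eexists.
pose W := walk Fs N1.+1; pose R := (N1.+1 * K + N1.+1 * K)%N.
have kk : (0 < k ^ 2)%N by rewrite expn_gt0 -(ltr0n rat) k0.
have N1k : (N1.+1 <= M.+1 * k ^ 2)%N by rewrite N1E mulSn -(add1n (M * k ^ 2)) leq_add2r.
have KN : (N1.+1 * K <= M.+1 * k ^ 2 * K)%N by rewrite leq_mul2r N1k orbT.
have gen (u v z : nat) : ((4 * u * v + 1) * z = 4 * (v * z * u) + z)%N by ring.
have AE : (A * k ^ 2 = 4 * (M.+1 * k ^ 2 * K) + k ^ 2)%N := gen K M.+1 (k ^ 2)%N.
clearbody A; have KN' : (N1 * K <= N1.+1 * K)%N by rewrite leq_mul2r leqnSn orbT.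
have RE : R = (N1.+1 * K + N1.+1 * K)%N by [].
have [RA NA] : (R.*2.+1 <= A * k ^ 2)%N /\ ((N1 * K).*2.+1 <= A * k ^ 2)%N.
  rewrite AE RE; clear -kk KN KN'; move: (N1 * K)%N (N1.+1 * K)%N (M.+1 * k ^ 2 * K)%N (k ^ 2)%N kk KN KN' => u0 u1 u2 u3.
  by lia.
have W0 : nonneg W by apply: nonneg_conv; [|apply: nonneg_refl]; apply: nonneg_cpow; apply: nonneg_bern_sum.
have Wa : supported a W.
  by apply: supported_conv; [|apply: supported_refl]; apply: supported_cpow; apply: supported_bern_sum.
have WR : bounded R W by apply: bounded_conv; [|apply: bounded_refl]; apply: bounded_cpow.
pose d j m := - (cmass W j m - cmass W j0 m).
pose e := C1 * k%:R ^+ 2 / k%:R ^+ M.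
have e0 : 0 <= e by rewrite !mulr_ge0 ?invr_ge0 ?exprn_ge0 // ltW.
have de j m : `|d j m| <= e by rewrite normrN /W N1E; apply: C1P; rewrite -(ltr0n rat).
have d0 j (m : int) : R%:Z < `|m| -> d j m = 0.
  by move=> mR; rewrite /d !(cmass_out _ WR) // subrr oppr0.
have := fixes_all fixP d0 de e0; set b := (X in fixes _ _ _ X).
move=> [s [h [g [s0 sa sE h0 hb]]]].
have bQ : C * b * (A * k ^ 2)%N%:R ^+ r < c.
  have k1 : 1 + R%:R <= (A * k ^ 2)%N%:R :> rat by rewrite nat1r ler_nat (leq_trans _ RA) // ltnS -addnn leq_addr.
  have b1 : b <= r%:R * (A * k ^ 2)%N%:R * (e * r%:R * (A * k ^ 2)%N%:R ^+ kp).
    have er : 0 <= e * r%:R by rewrite mulr_ge0.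
    have R1 : 0 <= 1 + R%:R :> rat by rewrite addr_ge0.
    rewrite /b natrM; apply: ler_pM.
    - by rewrite mulr_ge0.
    - by apply: mulr_ge0 => //; apply: exprn_ge0.
    - by rewrite ler_wpM2l // ler_nat.
    by rewrite ler_wpM2l //; apply: lerXn2r; rewrite ?nnegrE.
  apply: le_lt_trans (_ : Q / k%:R < c); last by rewrite ltr_pdivrMr.
  apply: le_trans (_ : C * (r%:R * (A * k ^ 2)%N%:R * (e * r%:R * (A * k ^ 2)%N%:R ^+ kp)) * (A * k ^ 2)%N%:R ^+ r <= _).
    by rewrite ler_wpM2r ?exprn_ge0 // ler_wpM2l.
  rewrite natrM natrX /e le_eqVlt; apply/orP; left; apply/eqP.
  have kM : k%:R ^+ M = k%:R ^+ 5 * (k%:R ^+ 2) ^+ kp * (k%:R ^+ 2) ^+ r :> rat.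
    by rewrite ME !exprD -!exprM !mul2n.
  rewrite kM /Q !exprMn [A%:R ^+ (kp.+1 + r)]exprD [A%:R ^+ kp.+1]exprS.
  have kn : k%:R != 0 :> rat by rewrite gt_eqF.
  move: (A%:R : rat) (k%:R : rat) kn => AA kq kn.
  have kn2 : kq ^+ 2 != 0 by rewrite expf_neq0.
  have := expf_neq0 kp kn2; have := expf_neq0 r kn2.
  move: ((kq ^+ 2) ^+ r) ((kq ^+ 2) ^+ kp) => y1 y2 n1' n2'.
  by field; rewrite kn !expf_neq0.
(* [W ++ s] realises [h], since [d] cancels the discrepancy of [W] from the reference column [j0].
   So [h] is also realised by a small signed measure [v] on [T]. *)
have [|v [[va [g' vE]] vT vb]] := coreP h b h0 _ hb.
  exists (W ++ s); split; first by rewrite /supported all_cat; apply/andP.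
  exists (fun m => cmass W j0 m + g m) => j m.
  by rewrite /cmass ev_cat -!/(cmass _ _ _) sE /d; ring.
(* [W ++ s] and [v] both have columns [h] up to a common part, so all columns of the difference
   agree. *)
pose t0 := W ++ s ++ wscale (-1) v.
have pmt x : pmass t0 x = pmass W x + pmass s x - pmass v x.
  by rewrite /pmass !ev_cat ev_wscale mulN1r addrA.
have big x : x \in X0 -> `|pmass v x| < pmass W x.
  move=> xX; apply: le_lt_trans (vb x) _.
  apply: lt_le_trans (walk_lower N1 F01 BK (FX x xX)).
  rewrite ltr_pdivlMr ?ltr0n ?expn_gt0 //.
  apply: lt_le_trans (cP _ xX); apply: le_lt_trans bQ.
  have b0 : 0 <= b by exact: le_trans (hb j0 0).
  rewrite natrX; apply: ler_wpM2l; first by rewrite mulr_ge0.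
  by apply: lerXn2r; rewrite ?nnegrE // ler_nat.
have pm0 x : 0 <= pmass t0 x.
  rewrite pmt; have [xT|xT] := boolP (x \in T).
    have := big x; rewrite mem_cat xT => /(_ isT); have := pmass_ge0 x s0; have := ler_norm (pmass v x); lra.
  by rewrite vT // subr0 addr_ge0 // pmass_ge0.
have [t [tE tU tP]] := collect t0.
exists t; split.
- by apply/allP => p pt; rewrite tP.
- apply/allP => p pt; have : p.2 \in [seq p.2 | p <- t] by apply: map_f.
  rewrite tU mem_undup => /mapP[q qt ->]; move: qt; rewrite !mem_cat => /or3P[||/mapP[q' qv ->]].
  + exact: (allP Wa).
  + exact: (allP sa).
  exact: (allP va) qv.
- have cmassE j n : cmass t j n = cmass W j0 n + g n - g' n.
    rewrite /cmass tE !ev_cat ev_wscale -!/(cmass _ _ _) sE vE /d; ring.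
  by move=> i j n; rewrite !cmassE.
exists (w j0); first by apply/eqP => w0; have := wi j0; rewrite w0 mxE.
rewrite /pmass tE -/(pmass t0 _) pmt.
have := big _ (wX j0); have := pmass_ge0 (w j0) s0; have := ler_norm (pmass v (w j0)); lra.
Qed.

(** * Integral models and p-adic absolute values *)

(** In case of equality at some [i], a vector of signs lies on the hyperplane. Together with its
    opposite it gives every column mass 1 at each of 1 and -1. *)
Theorem balanced_exists_le r (a : 'I_r -> int) : (0 < r)%N ->
  (forall i (d : int), (forall j, j != i -> (d %| a j)%Z) -> (d %| a i)%Z) ->
  (forall i, `|a i| <= \sum_(j < r | j != i) `|a j|) ->
  exists s : meas r, [/\ nonneg s, supported a s, forall i j n, cmass s i n = cmass s j n
    & exists2 x, x != 0 & 0 < pmass s x].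
Proof.
move=> r0 hd ha.
have [/forallP ha'|/forallPn[i]] := boolP [forall i, `|a i| < \sum_(j < r | j != i) `|a j|].
  exact: balanced_exists.
rewrite -leNgt => ai; have {ha ai} aE : `|a i| = \sum_(j < r | j != i) `|a j|.
  by apply/eqP; rewrite eq_le ha ai.
pose sg' (z : int) : int := if 0 <= z then 1 else -1.
have sgE z : z * sg' z = `|z| by rewrite /sg'; case: ifP; lia.
pose x : 'rV[int]_r := \row_j (if j == i then - sg' (a i) else sg' (a j)).
have ox : orth a x.
  rewrite /orth (bigD1 i) //= mxE eqxx mulrN sgE aE addrC subr_eq0; apply/eqP.
  by apply: eq_bigr => j /negPf ji; rewrite mxE ji sgE.
have x1 j : (x 0 j == 1) || (x 0 j == -1).
  by rewrite mxE /sg'; do 2 case: ifP => _; rewrite ?opprK ?eqxx ?orbT.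
exists [:: (1, x); (1, - x)]; split => //.
- by rewrite /supported /= ox orthN.
- have E j n : cmass [:: (1, x); (1, - x)] j n = (n == 1)%:R + (n == -1)%:R.
    rewrite /cmass /ev !big_cons big_nil /= [(- x) _ _]mxE addr0 !mul1r.
    by case/orP: (x1 j) => /eqP->; rewrite ?opprK ![_ == n]eq_sym // addrC.
  by move=> j j' n; rewrite !E.
exists x.
  by apply/eqP => x0; have := x1 (Ordinal r0); rewrite x0 mxE.
rewrite /pmass /ev !big_cons big_nil /= eqxx addr0; case: (_ == _); rewrite ?mulr1 ?mulr0 //.
Qed.

Lemma int_model r (a : 'I_r -> rat) : exists (b : 'I_r -> int) (D : nat),
  (0 < D)%N /\ forall i, a i * D%:R = (b i)%:~R.
Proof.
pose D := (\prod_i absz (denq (a i)))%N.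
exists (fun i => numq (a i) * (\prod_(j | j != i) absz (denq (a j)))%N%:Z), D; split.
  by rewrite prodn_gt0 // => i; rewrite absz_gt0 denq_neq0.
move=> i; rewrite /D (bigD1 i) //= natrM mulrA rmorphM /=; congr (_ * _).
by rewrite -[(absz _)%:R]/((absz (denq (a i)))%:Z%:~R) absz_denq numqE.
Qed.

Lemma padic_val_frac p (x : rat) (X : int) (D : nat) : x != 0 -> (0 < D)%N -> x * D%:R = X%:~R ->
  padic_val p x = (logn p (absz X))%:Z - (logn p D)%:Z.
Proof.
move=> x0 D0 xX.
have E : (absz (numq x) * D = absz X * absz (denq x))%N.
  have : (numq x * D%:Z)%:~R = (X * denq x)%:~R :> rat.
    by rewrite !rmorphM /= -xX numqE mulrAC.
  by move/eqP; rewrite eqr_int => /eqP/(congr1 absz); rewrite !abszM absz_nat.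
have X0 : (0 < absz X)%N.
  by rewrite absz_gt0 -(intr_eq0 rat) -xX mulf_neq0 // pnatr_eq0 -lt0n.
have n0 : (0 < absz (numq x))%N by rewrite absz_gt0 numq_eq0.
have d0 : (0 < absz (denq x))%N by rewrite absz_gt0 denq_neq0.
by have := congr1 (logn p) E; rewrite !lognM // /padic_val; lia.
Qed.

Lemma padic_abs0 p : padic_abs p 0 = 0. Proof. by rewrite /padic_abs eqxx. Qed.

Lemma padic_abs_gt0 p x : prime p -> x != 0 -> 0 < padic_abs p x.
Proof. by move=> pp x0; rewrite /padic_abs (negPf x0) exprz_gt0 // ltr0n prime_gt0. Qed.

Lemma padic_abs_ge0 p x : prime p -> 0 <= padic_abs p x.
Proof. by move=> pp; have [->|x0] := eqVneq x 0; [rewrite padic_abs0|apply: ltW; apply: padic_abs_gt0]. Qed.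

Lemma padic_abs_le p x y : prime p -> x != 0 -> y != 0 -> (padic_abs p x <= padic_abs p y) = (padic_val p y <= padic_val p x).
Proof.
move=> pp x0 y0; rewrite /padic_abs (negPf x0) (negPf y0) ler_eXz2l ?lerN2 //.
by rewrite ltr1n prime_gt1.
Qed.

Lemma padic_absM p x y : prime p -> padic_abs p (x * y) = padic_abs p x * padic_abs p y.
Proof.
move=> pp; have [->|x0] := eqVneq x 0; first by rewrite mul0r padic_abs0 mul0r.
have [->|y0] := eqVneq y 0; first by rewrite mulr0 padic_abs0 mulr0.
have xy0 : x * y != 0 by rewrite mulf_neq0.
rewrite /padic_abs (negPf x0) (negPf y0) (negPf xy0) -expfzDr; last first.
  by rewrite pnatr_eq0 -lt0n prime_gt0.
congr (_ ^ _); rewrite -opprD; congr (- _).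
have dD (z : rat) : (0 < absz (denq z))%N by rewrite absz_gt0 denq_neq0.
have zD (z : rat) : z * (absz (denq z))%:R = (numq z)%:~R.
  by rewrite -[(absz _)%:R]/((absz (denq z))%:Z%:~R) absz_denq numqE.
rewrite (@padic_val_frac p (x * y) (numq x * numq y) (absz (denq x) * absz (denq y))%N) //; last 2 first.
- by rewrite muln_gt0 !dD.
- by rewrite natrM rmorphM /= -!zD; ring.
by rewrite abszM !lognM ?absz_gt0 ?numq_eq0 ?dD // /padic_val !PoszD; ring.
Qed.

(** Over a common denominator the ultrametric inequality says that a power of [p] dividing two
    integers divides their sum. *)
Lemma padic_absD p x y c : prime p -> padic_abs p x <= c -> padic_abs p y <= c -> padic_abs p (x + y) <= c.
Proof.
move=> pp xc yc; have [->|x0] := eqVneq x 0; first by rewrite add0r.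
have [->|y0] := eqVneq y 0; first by rewrite addr0.
have [->|s0] := eqVneq (x + y) 0; first by rewrite padic_abs0 (le_trans _ xc) // padic_abs_ge0.
have [b [D [D0 bD]]] := @int_model 2 (fun i => if i == ord0 then x else y).
have xX := bD ord0; have yY := bD ord_max; rewrite /= in xX yY.
set X := b ord0 in xX; set Y := b ord_max in yY.
have sS : (x + y) * D%:R = (X + Y)%:~R by rewrite mulrDl xX yY rmorphD.
have DR : D%:R != 0 :> rat by rewrite pnatr_eq0 -lt0n.
have nz (z : rat) (Z : int) : z != 0 -> z * D%:R = Z%:~R -> (0 < absz Z)%N.
  by move=> z0 zZ; rewrite absz_gt0 -(intr_eq0 rat) -zZ mulf_neq0.
have key : (minn (logn p (absz X)) (logn p (absz Y)) <= logn p (absz (X + Y)%R))%N.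
  rewrite -pfactor_dvdn ?(nz _ _ s0 sS) //.
  have h (Z : int) z : (z <= logn p (absz Z))%N -> ((p ^ z)%N%:Z %| Z)%Z.
    move=> zZ; rewrite dvdzE /= (dvdn_trans (dvdn_exp2l p zZ)) //; exact: pfactor_dvdnn.
  have : ((p ^ minn (logn p (absz X)) (logn p (absz Y)))%N%:Z %| X + Y)%Z.
    by apply: rpredD; apply: h; rewrite ?geq_minl ?geq_minr.
  by rewrite dvdzE.
have [le|le] := leqP (logn p (absz X)) (logn p (absz Y)).
  apply: le_trans xc; rewrite padic_abs_le // (padic_val_frac _ x0 D0 xX) (padic_val_frac _ s0 D0 sS).
  by lia.
apply: le_trans yc; rewrite padic_abs_le // (padic_val_frac _ y0 D0 yY) (padic_val_frac _ s0 D0 sS).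
by lia.
Qed.

Lemma padic_abs_sum p (I : Type) (s : seq I) (P : pred I) (F : I -> rat) c : prime p -> 0 <= c ->
  (forall i, P i -> padic_abs p (F i) <= c) -> padic_abs p (\sum_(i <- s | P i) F i) <= c.
Proof.
move=> pp c0 H; apply: (big_ind (fun x => padic_abs p x <= c)); first by rewrite padic_abs0.
  by move=> x y xc yc; apply: padic_absD.
exact: H.
Qed.

Lemma padic_absN p x : padic_abs p (- x) = padic_abs p x.
Proof. by rewrite /padic_abs oppr_eq0 /padic_val numqN denqN abszN. Qed.

(** Divisibility is tested one prime at a time: the power of [p] in [d] divides the [b j] of an
    index [j] that is [p]-adically at least as large as [i]. *)
Lemma dvd_of_padic_abs r (a : 'I_r -> rat) (b : 'I_r -> int) (D : nat) i (d : int) :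
  (0 < D)%N -> (forall j, a j * D%:R = (b j)%:~R) ->
  (forall p, prime p -> a i != 0 -> exists2 j, j != i & padic_abs p (a i) <= padic_abs p (a j)) ->
  (forall j, j != i -> (d %| b j)%Z) -> (d %| b i)%Z.
Proof.
move=> D0 ab H dj; have [ai|ai] := eqVneq (a i) 0.
  have -> : b i = 0 by apply/eqP; rewrite -(intr_eq0 rat) -ab ai mul0r.
  exact: dvdz0.
have DR : D%:R != 0 :> rat by rewrite pnatr_eq0 -lt0n.
have nz j : a j != 0 -> (0 < absz (b j))%N.
  by move=> aj; rewrite absz_gt0 -(intr_eq0 rat) -ab mulf_neq0.
have loc p : prime p -> exists2 j, j != i & (a j != 0) && (logn p (absz (b j)) <= logn p (absz (b i)))%N.
  move=> pp; have [j ji le] := H p pp ai; exists j => //.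
  have aj : a j != 0.
    by apply/eqP => aj; rewrite aj padic_abs0 leNgt padic_abs_gt0 in le.
  rewrite aj /=; move: le; rewrite padic_abs_le // (padic_val_frac _ ai D0 (ab i)) (padic_val_frac _ aj D0 (ab j)).
  by lia.
have d0 : (0 < absz d)%N.
  (* Any prime serves to find a nonzero [b j] that [d] divides. *)
  have [j ji /andP[aj _]] := loc 2 isT; have := dj j ji.
  by rewrite absz_gt0; apply: contraTneq => ->; rewrite dvd0z -absz_gt0 nz.
rewrite dvdzE; apply/dvdn_partP => // p; rewrite mem_primes => /and3P[pp _ _].
have [j ji /andP[aj le]] := loc p pp.
rewrite p_part pfactor_dvdn ?nz //; apply: leq_trans le.
by apply: dvdn_leq_log; rewrite ?nz // -dvdzE dj.
Qed.

(** * Probability measures *)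

Lemma discrete_prob (R : realType) (d : measure_display) (T : measurableType d)
  (n : nat) (w : nat -> R) (t : nat -> T) : (forall k, 0 <= w k) -> 0 < \sum_(k < n) w k ->
  exists mu : probability T R, forall A : set T,
    mu A = ((\sum_(k < n) w k * (t k \in A)%:R) / \sum_(k < n) w k)%:E.
Proof.
move=> w0 W0.
pose m : {measure set T -> \bar R} := msum (fun k => mscale (NngNum (w0 k)) (dirac (t k))) n.
have mE A : m A = (\sum_(k < n) w k * (t k \in A)%:R)%:E.
  rewrite /m /= /msum -sumEFin; apply: eq_bigr => k _.
  by rewrite /= /mscale /= /dirac indicE -EFinM.
have mT : m setT = (\sum_(k < n) w k)%:E.
  by rewrite mE; congr (_%:E); apply: eq_bigr => k _; rewrite in_setT mulr1.
(* The Dirac mass is the default of [mnormalize] for total mass 0 or infinity, which does not occur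
   here. *)
exists (mnormalize m (dirac (t 0%N))) => A.
rewrite /= /mnormalize mT eqe gt_eqF //= -[msum _ _ A]/(m A) mE.
by rewrite -EFinM.
Qed.

Lemma balanced_fun r (s : meas r) i j (f : int -> rat) :
  (forall n, cmass s i n = cmass s j n) -> ev s (fun x => f (x 0 i)) = ev s (fun x => f (x 0 j)).
Proof.
move=> H; pose V := undup ([seq p.2 0 i | p : rat * 'rV[int]_r <- s] ++ [seq p.2 0 j | p : rat * 'rV[int]_r <- s]).
have E k : {subset [seq p.2 0 k | p : rat * 'rV[int]_r <- s] <= V} ->
    ev s (fun x => f (x 0 k)) = \sum_(n <- V) f n * cmass s k n.
  move=> sV; rewrite /cmass /ev; under [RHS]eq_bigr do rewrite mulr_sumr.
  rewrite exchange_big /=; apply: eq_big_seq => p ps.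
  have pV : p.2 0 k \in V by apply/sV/mapP; exists p.
  rewrite (bigD1_seq (p.2 0 k)) ?undup_uniq //= eqxx mulr1 mulrC big1 ?addr0 // => n /negPf.
  by rewrite eq_sym => ->; rewrite !mulr0.
rewrite !E; first by apply: eq_bigr => n _; rewrite H.
  by move=> n; rewrite mem_undup mem_cat => ->; rewrite orbT.
by move=> n; rewrite mem_undup mem_cat => ->.
Qed.

Definition tup r (x : 'rV[int]_r) : r.-tuple rat := [tuple (x 0 i)%:~R | i < r].

Lemma measure_of_balanced (R : realType) (r : nat) (a : 'I_r -> rat) (b : 'I_r -> int) (D : nat)
    (s : meas r) (x0 : 'rV[int]_r) :
  (0 < D)%N -> (forall i, a i * D%:R = (b i)%:~R) ->
  nonneg s -> supported b s -> (forall i j n, cmass s i n = cmass s j n) -> x0 != 0 -> 0 < pmass s x0 ->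
  exists mu : probability (r.-tuple rat) R,
    [/\ finitely_supported_in mu (hyperplane a),
        ~ same_law mu (@dirac _ _ (origin r) R)
      & forall i j : 'I_r,
          same_law (distribution mu (coordinate i)) (distribution mu (coordinate j))].
Proof.
move=> D0 ab s0 sb bal x00 px0.
pose w k : R := ratr (nth (0, 0) s k).1.
pose t k := tup (nth (0, 0) s k).2.
have big (F : rat * 'rV[int]_r -> R) : \sum_(k < size s) F (nth (0, 0) s k) = \sum_(p <- s) F p.
  by rewrite (big_nth (0, 0)) big_mkord.
have w0 k : 0 <= w k.
  rewrite ler0q; have [ks|ks] := ltnP k (size s); last by rewrite nth_default.
  by apply: (allP s0); rewrite mem_nth.
have evE f : \sum_(k < size s) w k * f (nth (0, 0) s k).2 = \sum_(p <- s) ratr p.1 * f p.2.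
  by rewrite -big.
have W E : \sum_(p <- s) ratr p.1 * (E p.2 : bool)%:R = ratr (ev s (fun x => (E x)%:R)) :> R.
  rewrite /ev rmorph_sum /=; apply: eq_bigr => p _.
  by rewrite rmorphM /= ratr_nat.
have TT : \sum_(k < size s) w k = ratr (ev s (fun=> 1)).
  rewrite -(W (fun=> true)) -(evE (fun=> true%:R)); by apply: eq_bigr => k _; rewrite mulr1.
have T0 : 0 < ev s (fun=> 1).
  by apply: lt_le_trans px0 _; apply: ev_le => // y; case: (_ == _).
have [|mu muE] := @discrete_prob R _ (r.-tuple rat : measurableType _) (size s) w t w0.
  by rewrite TT ltr0q.
have {}muE A : mu A = (ratr (ev s (fun x => (tup x \in A)%:R)) / ratr (ev s (fun=> 1)))%:E.
  by rewrite muE TT (evE (fun x => (tup x \in A)%:R)) (W (fun x => tup x \in A)).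
exists mu; split.
- exists [set` [seq tup p.2 | p <- s]]; split; first exact: finite_seq.
    move=> _ /= /mapP[p ps ->]; rewrite /hyperplane /=.
    have DR : D%:R != 0 :> rat by rewrite pnatr_eq0 -lt0n.
    apply: (mulfI DR); rewrite mulr0 mulr_sumr.
    have /eqP := allP sb _ ps; move=> /(congr1 (fun z => z%:~R : rat)); rewrite rmorph_sum /= => E.
    rewrite -[RHS]E; apply: eq_bigr => i _.
    by rewrite /coordinate tnth_mktuple rmorphM /= -ab; ring.
  rewrite muE; congr (_%:E).
  have -> : ev s (fun x => (tup x \in [set` [seq tup p.2 | p <- s]])%:R) = ev s (fun=> 1).
    apply: eq_big_seq => p ps; rewrite mem_set //=; exact: map_f.
  by rewrite mulfV // fmorph_eq0 gt_eqF.
(* The point [tup x0] has positive mass, while the point mass at the origin gives it 0. *)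
- move=> /(_ [set tup x0] (measurable_tuple_rat _)).
  rewrite muE diracE memNset /=; last first.
    move=> E; case/eqP: x00; apply/rowP => i; rewrite mxE.
    have := congr1 (fun z => tnth z i) E; rewrite /origin !tnth_mktuple => /esym/eqP.
    by rewrite intr_eq0 => /eqP.
  move=> [] /eqP; apply/negP; rewrite gt_eqF // divr_gt0 ?ltr0q //.
  apply: lt_le_trans px0 _; apply: ev_le => // y.
  by case: eqP => [->|_]; rewrite ?ler0n // mem_set.
move=> i j A mA; rewrite /distribution /pushforward /= !muE; congr ((ratr _ / _)%:E).
have F k : ev s (fun x => (tup x \in coordinate k @^-1` A)%:R) = ev s (fun x => ((x 0 k)%:~R \in A)%:R).
  apply: eq_ev => x; congr ((nat_of_bool _)%:R); apply/idP/idP; rewrite !inE /= /coordinate tnth_mktuple //.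
rewrite !F; exact: (@balanced_fun _ s i j (fun n => (n%:~R \in A)%:R)).
Qed.

(** There are finitely many atoms and one of them is nonzero, so the sizes [N] of their coordinates
    have a positive maximum [M]. The value that attains it in one column has positive probability in
    every column, because the marginals agree, and so occurs in an atom there. *)
Lemma extremal_atom (R : realType) (r : nat) (a : 'I_r -> rat) (mu : probability (r.-tuple rat) R)
    (N : rat -> rat) :
  N 0 = 0 -> (forall x, x != 0 -> 0 < N x) ->
  finitely_supported_in mu (hyperplane a) -> ~ same_law mu (@dirac _ _ (origin r) R) ->
  (forall i j : 'I_r, same_law (distribution mu (coordinate i)) (distribution mu (coordinate j))) ->
  exists2 M, 0 < M & forall i, exists t, [/\ hyperplane a t, N (tnth t i) = M & forall j, N (tnth t j) <= M].
Proof.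
move=> N0 Npos [S [/finite_seqP[l ->] lH muS]] ndirac marg.
have mT := @measurable_tuple_rat r.
have null (A : set (r.-tuple rat)) (l' : seq (r.-tuple rat)) : (forall t, t \in l' -> A t -> mu [set t] = 0%E) -> mu (A `&` [set` l']) = 0%E.
  elim: l' => [|t l' IH] H; first by rewrite set_nil setI0 measure0.
  have -> : A `&` [set` t :: l'] = (A `&` [set t]) `|` (A `&` [set` l']).
    apply/seteqP; split => u /=; first by rewrite in_cons => -[Au /predU1P[]]; [left|right].
    by case=> -[Au ut]; split => //; rewrite in_cons ut ?eqxx ?orbT.
  apply/eqP; rewrite eq_le measure_ge0 andbT.
  apply: le_trans (measureU2 _ _ _) _ => //.
  have IH' : mu (A `&` [set` l']) = 0%E by apply: IH => u ul; apply: H; rewrite in_cons ul orbT.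
  rewrite [X in (_ + X)%E]IH' adde0.
  have [At|nAt] := pselect (A t).
    rewrite -(H t) ?mem_head //; apply: le_measure; rewrite ?inE //.
  rewrite (_ : A `&` [set t] = set0) ?measure0 //.
  by apply/seteqP; split => // u [Au /= ut]; rewrite ut in Au.
have nullC : mu (~` [set` l]) = 0%E.
  by rewrite probability_setC // muS subee.
have atom (A : set (r.-tuple rat)) : mu A != 0%E -> exists t, [/\ t \in l, A t & mu [set t] != 0%E].
  move=> muA; apply: contrapT => H; case/negP: muA; apply/eqP.
  have Z : mu (A `&` [set` l]) = 0%E.
    apply: null => t tl At; apply: contrapT => /eqP mt; apply: H; by exists t.
  apply/eqP; rewrite eq_le measure_ge0 andbT.
  have : A `<=` (A `&` [set` l]) `|` ~` [set` l].
    by move=> t At; have [tl|tl] := pselect ([set` l] t); [left|right].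
  move=> /(@le_measure _ _ _ mu _ _ _ _) H'; apply: le_trans (H' _ _) _; rewrite ?inE //.
  by apply: le_trans (measureU2 _ _ _) _ => //; rewrite [X in (X + _)%E]Z [X in (_ + X)%E]nullC adde0.
pose U := [seq t <- l | mu [set t] != 0%E].
have [t0 t0U t0o] : exists2 t, t \in U & t != origin r.
  have [Z|Z] := eqVneq (mu (~` [set origin r])) 0%E; last first.
    have [t [tl /eqP to mt]] := atom _ Z; exists t => //.
    by rewrite mem_filter mt.
  (* Without mass off the origin, [mu] would be the point mass there. *)
  exfalso; apply: ndirac => A mA.
  have mo : mu [set origin r] = 1%E.
    have := probability_setC mu (mT [set origin r]); rewrite Z => /esym/eqP.
    by rewrite sube_eq ?add0e // => /eqP.
  rewrite diracE; have [oA|oA] := boolP (origin r \in A).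
    apply/eqP; rewrite eq_le probability_le1 //= -mo; apply: le_measure; rewrite ?inE //.
    by move=> _ ->; rewrite inE in oA.
  apply/eqP; rewrite eq_le measure_ge0 andbT.
  apply: (@le_trans _ _ (mu (~` [set origin r]))); last by rewrite Z.
  apply: le_measure; rewrite ?inE //.
  by move=> t At /= to; case/negP: oA; rewrite -to inE.
pose V := [seq N (tnth t j) | t <- U, j <- enum 'I_r].
have VP t j : t \in U -> N (tnth t j) \in V.
  by move=> tU; apply/allpairsP; exists (t, j); rewrite mem_enum.
pose M := \big[Num.max/0]_(v <- V) v.
have VM v : v \in V -> v <= M by move=> vV; exact: (@le_bigmax_seq _ _ _ V 0 v xpredT id vV isT).
have Nge x : 0 <= N x by have [->|/Npos/ltW] := eqVneq x 0; rewrite ?N0.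
have M0 : 0 < M.
  have [j tj] : exists j, tnth t0 j != 0.
    apply/existsP; apply: contraNT t0o => /existsPn H; apply/eqP/eq_from_tnth => j.
    by rewrite tnth_mktuple; apply/eqP/negPn.
  exact: lt_le_trans (Npos _ tj) (VM _ (VP _ _ t0U)).
(* The maximum is a member of [V] or the default 0, and [M0] excludes the latter. *)
have : M \in V.
  have : (M == 0) || (M \in V).
    rewrite /M; elim: (V) => [|v V' IH]; first by rewrite big_nil eqxx.
    rewrite big_cons in_cons; case: (leP v) => _; last by rewrite eqxx orbT.
    by case/orP: IH => ->; rewrite ?orbT.
  by rewrite gt_eqF.
move=> /allpairsP[[t1 j1] /= [t1U _ ME]].
exists M => // i; pose v := tnth t1 j1.
have : distribution mu (coordinate i) [set v] != 0%E.
  rewrite (marg i j1) //; move: t1U; rewrite mem_filter => /andP[mt _].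
  rewrite gt_eqF //; apply: (@lt_le_trans _ _ (mu [set t1])).
    by rewrite lt_neqAle eq_sym mt measure_ge0.
  by rewrite /distribution /pushforward; apply: le_measure; rewrite ?inE // => _ ->.
move=> /atom[t [tl tv mt]].
have tU : t \in U by rewrite mem_filter mt.
exists t; split; first exact: lH.
  by rewrite ME; congr N.
by move=> j; apply/VM/VP.
Qed.

Theorem theorem1p1 (R : realType) (r : nat) (r_gt0 : (0 < r)%N)
    (a : 'I_r -> rat) :
  (exists mu : probability (r.-tuple rat) R,
    [/\ finitely_supported_in mu (hyperplane a),
        ~ same_law mu (@dirac _ _ (origin r) R)
      & forall i j : 'I_r,
          same_law (distribution mu (coordinate i)) (distribution mu (coordinate j))])
  <->
  ((forall (p : nat) (i : 'I_r), prime p ->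
      padic_abs p (a i) <= \big[Num.max/0]_(j < r | j != i) padic_abs p (a j))
   /\
   (forall i : 'I_r, `|a i| <= \sum_(j < r | j != i) `|a j|)).
Proof.
split=> [[mu [fin nd marg]]|[padic arch]].
  (* At an atom whose coordinate [i] has the extremal size [M], the size of the right side is at
     most [M] times the bound in the local condition; dividing by [M] gives the condition. *)
  have solve (t : r.-tuple rat) i : hyperplane a t ->
      a i * tnth t i = - \sum_(j | j != i) a j * tnth t j.
    by move=> /eqP; rewrite (bigD1 i) //= addr_eq0 => /eqP.
  split=> [p i pp|i].
    have [M M0 ext] := extremal_atom (padic_abs0 p) (fun x => @padic_abs_gt0 p x pp) fin nd marg.
    have [t [ht tM tle]] := ext i.
    rewrite -(ler_pM2r M0) -{1}tM -padic_absM // (solve t i ht) padic_absN.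
    have c0 : 0 <= \big[Num.max/0]_(j < r | j != i) padic_abs p (a j) by apply: bigmax_ge_id.
    apply: padic_abs_sum => // [|j ji]; first by rewrite mulr_ge0 // ltW.
    rewrite padic_absM // ler_pM ?padic_abs_ge0 //.
    exact: (le_bigmax_cond _ (fun j => padic_abs p (a j)) ji).
  have [|x|M M0 ext] := extremal_atom (N := fun x => `|x|) _ _ fin nd marg.
  - exact: normr0.
  - by rewrite normr_gt0.
  have [t [ht tM tle]] := ext i.
  rewrite -(ler_pM2r M0) -{1}tM -normrM (solve t i ht) normrN mulr_suml.
  apply: le_trans (ler_norm_sum _ _ _) _; apply: ler_sum => j ji.
  by rewrite normrM ler_wpM2l.
have [b [D [D0 ab]]] := int_model a.
have DR : 0 < D%:R :> rat by rewrite ltr0n.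
have bE i : (`|b i|)%:~R = `|a i| * D%:R :> rat.
  by rewrite intr_norm -ab normrM (ger0_norm (ltW DR)).
have [||s [s0 sb bal [x x0 px]]] := @balanced_exists_le r b r_gt0.
- move=> i d; apply: (dvd_of_padic_abs D0 ab) => p pp ai.
  (* If every other [a j] were strictly smaller, so would be their maximum; its default 0 is smaller
     too, as [a i] is nonzero. *)
  apply: contrapT => H; have := padic p i pp; rewrite leNgt => /negP; apply.
  apply: (big_ind (fun x => x < padic_abs p (a i))); first exact: padic_abs_gt0.
    by move=> x y xa ya; rewrite gt_max xa.
  by move=> j ji; rewrite ltNge; apply/negP => le; apply: H; exists j.
- move=> i; rewrite -(ler_int rat) rmorph_sum /= bE.
  under eq_bigr do rewrite bE.
  by rewrite -mulr_suml ler_pM2r.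
exact: (measure_of_balanced R D0 ab s0 sb bal x0 px).
Qed.
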